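(* For each $n\ge 1$, let $\boldsymbol{G}_n$ be a uniform random unlabeled circle graph with $n$ vertices (all $\boldsymbol{G}_n$ being defined on a common probability space). Then, in the space of graphons, $\boldsymbol{G}_n \to W^{(\mathrm{circle})}$ almost surely as $n\to+\infty$, i.e. $\delta_{\Box}(W_{\boldsymbol{G}_n},W^{(\mathrm{circle})})\to 0$ almost surely.
   Context: Circle graphs. A matching of size $n$ is a fixed-point free involution $\mathfrak m$ on $\{1,\dots,2n\}$; it is represented by the $n$ chords of the unit circle joining $e^{2\mathbf i\pi i/(2n)}$ to $e^{2\mathbf i\pi \mathfrak m(i)/(2n)}$. $G_{\mathfrak m}$ denotes the unlabeled intersection graph of these chords: its vertices are the $n$ chords, two distinct chords being adjacent iff they intersect. A circle graph with $n$ vertices is an unlabeled graph (graph up to isomorphism) equal to $G_{\mathfrak m}$ for some matching $\mathfrak m$ of size $n$. Uniform means uniform over the finite set of unlabeled circle graphs with $n$ vertices. Graphons. A graphon is represented by a symmetric measurable function $w:[0,1]^2\to[0,1]$. The cut metric is $\delta_{\Box}(u,w)=\inf_{\phi}\sup_{S,T\subseteq[0,1]}\left|\int_{S\times T}\big(u(x,y)-w(\phi(x),\phi(y))\big)\,dx\,dy\right|$, where $\phi$ ranges over invertible Lebesgue-measure-preserving maps $[0,1]\to[0,1]$ and $S,T$ over measurable sets. The space of graphons is the set of such functions, with functions at $\delta_\Box$-distance $0$ identified, with the metric $\delta_\Box$. To a graph $G$ with $n$ vertices labeled $1,\dots,n$ and adjacency matrix $A$ one associates the graphon $W_G$ represented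 by $w_G(x,y)=A_{\lceil nx\rceil,\lceil ny\rceil}$; it does not depend on the labeling. A sequence of graphs $H_n$ converges to $W$ if $\delta_\Box(W_{H_n},W)\to0$. The limit. For reals $x_A,x_B,y_A,y_B\in[0,1]$, the pairs $(x_A,x_B)$ and $(y_A,y_B)$ are crossing if the four numbers are pairwise distinct and the chord joining $e^{2\mathbf i\pi x_A}$ and $e^{2\mathbf i\pi x_B}$ intersects the chord joining $e^{2\mathbf i\pi y_A}$ and $e^{2\mathbf i\pi y_B}$. Let $\Psi=(\Psi_A,\Psi_B):[0,1]\to[0,1]^2$ be any measurable function pushing Lebesgue measure on $[0,1]$ to Lebesgue measure on $[0,1]^2$. $W^{(\mathrm{circle})}$ is the graphon represented by $(x,y)\mapsto \mathbb 1[(\Psi_A(x),\Psi_B(x))\text{ and }(\Psi_A(y),\Psi_B(y))\text{ are crossing}]$; as an element of the space of graphons it does not depend on the choice of $\Psi$. *)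

(* Defs.v *)
From HB Require Import structures.
From mathcomp Require Import all_boot all_order all_algebra all_fingroup.
From mathcomp Require Import generic_quotient.
From mathcomp Require Import all_classical all_reals all_analysis.
From mathcomp Require Import measurable_realfun lra.

Set Implicit Arguments.
Unset Strict Implicit.
Unset Printing Implicit Defensive.

Import Order.TTheory GRing.Theory Num.Theory.
Import numFieldNormedType.Exports.

Local Open Scope classical_set_scope.
Local Open Scope quotient_scope.
Local Open Scope ring_scope.

Definition simple_adj n (A : 'M[bool]_n) : bool :=
  [forall i, ~~ A i i] && [forall i, forall j, A i j == A j i].

Definition sgraph n := {A : 'M[bool]_n | simple_adj A}.
HB.instance Definition _ n := Finite.on (sgraph n).

Definition adj n (G : sgraph n) : rel 'I_n := fun i j => val G i j.

Definition graph_iso (T1 T2 : Type) (e1 : rel T1) (e2 : rel T2) : Prop :=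
  exists f : T1 -> T2, bijective f /\ forall x y, e1 x y = e2 (f x) (f y).

Definition isob n : rel (sgraph n) := fun G H => `[< graph_iso (adj G) (adj H) >].

Lemma isob_refl n : reflexive (@isob n).
Proof. by move=> G; apply/asboolP; exists id; split => //; exists id. Qed.

Lemma isob_sym n : symmetric (@isob n).
Proof.
suff h (G H : sgraph n) : isob G H -> isob H G by move=> G H; apply/idP/idP; exact: h.
move=> /asboolP[f [[g fK gK] fe]]; apply/asboolP; exists g; split; first by exists f.
by move=> x y; rewrite fe !gK.
Qed.

Lemma isob_trans n : transitive (@isob n).
Proof.
move=> H G K /asboolP[f [bf fe]] /asboolP[g [bg ge]]; apply/asboolP.
by exists (g \o f); split; [exact: bij_comp|move=> x y; rewrite fe ge].
Qed.

Canonical isob_equiv n := EquivRel (@isob n) (@isob_refl n) (@isob_sym n) (@isob_trans n).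

Definition ugraph n := {eq_quot (@isob_equiv n)}.
HB.instance Definition _ n := Countable.on (ugraph n).
HB.instance Definition _ n :=
  fintype.isFinite.Build (ugraph n) (pcan_enumP (can_pcan (@reprK _ (ugraph n)))).

(* An arbitrary labeling: isomorphic labeled graphs give the same [circle_graph]
   predicate and graphons at cut distance 0. *)
Definition labeled n (u : ugraph n) : sgraph n := repr u.

Section circle_graphs.
Variable R : realType.
Implicit Types a b : R.

Definition circle_pt a : R * R := (cos (2 * pi * a), sin (2 * pi * a)).

Definition chord a b : set (R * R) :=
  [set (1 - t) *: circle_pt a + t *: circle_pt b | t in `[0, 1]].

Definition matching n (m : 'I_(n.*2) -> 'I_(n.*2)) : Prop :=
  involutive m /\ forall i, m i != i.

(* ['I_(2n)] stands for {1, .., 2n}, the ordinal [i] being the integer [i + 1] *)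
Definition matching_pt n (i : 'I_(n.*2)) : R := i.+1%:R / (n.*2)%:R.

(* a chord of the matching is indexed by the smaller of its two ends *)
Definition chord_index n (m : 'I_(n.*2) -> 'I_(n.*2)) :=
  {i : 'I_(n.*2) | (i < m i)%N}.

Definition chord_of n m (c : @chord_index n m) : set (R * R) :=
  chord (matching_pt (val c)) (matching_pt (m (val c))).

Definition chord_adj n m : rel (@chord_index n m) := fun c c' =>
  (c != c') && `[< chord_of c `&` chord_of c' !=set0 >].

Definition circle_graph n (u : ugraph n) : Prop :=
  exists2 m, matching m & graph_iso (adj (labeled u)) (@chord_adj n m).

End circle_graphs.

Definition uniform_circle_graph (R : realType) d (Omega : measurableType d)
    (P : probability Omega R) n (G : Omega -> ugraph n) : Prop :=
  let circle := [set u : ugraph n | `[< circle_graph R u >]]%SET in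
  forall u : ugraph n, measurable (G @^-1` [set u]) /\
    P (G @^-1` [set u]) = (if u \in circle then #|circle|%:R^-1 else 0)%:E.

Section graphons.
Variable R : realType.

Local Notation I01 := (`[0, 1]%classic : set R).
Local Notation leb := (@lebesgue_measure R).

(* Measurability is Borel measurability throughout; every Lebesgue measurable
   function or set agrees almost everywhere with a Borel one, so that this
   changes neither the space of graphons nor the cut distance. *)
Record graphon := Graphon {
  gfun :> R * R -> R ;
  graphon_measurable : measurable_fun (I01 `*` I01) gfun ;
  graphon_sym : forall x y, I01 x -> I01 y -> gfun (x, y) = gfun (y, x) ;
  graphon_itv : forall x y, I01 x -> I01 y -> 0 <= gfun (x, y) <= 1 }.

Definition measure_preserving01 (f : R -> R) : Prop :=
  [/\ measurable_fun I01 f, f @` I01 `<=` I01 &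
    forall A, measurable A -> A `<=` I01 -> leb (I01 `&` f @^-1` A) = leb A].

Definition invertible_mp01 (phi : R -> R) : Prop :=
  measure_preserving01 phi /\ exists psi, [/\ measure_preserving01 psi,
    forall x, I01 x -> psi (phi x) = x & forall x, I01 x -> phi (psi x) = x].

Definition cut_dist (u w : graphon) : \bar R :=
  ereal_inf [set ereal_sup
    [set `|\int[leb \x leb]_(z in ST.1 `*` ST.2)
            (u z - w (phi z.1, phi z.2))%:E|%E
    | ST in [set ST : set R * set R |
        (measurable ST.1 /\ ST.1 `<=` I01) /\ (measurable ST.2 /\ ST.2 `<=` I01)]]
  | phi in invertible_mp01].

(* The entry of the adjacency matrix at row [ceil (n x)] and column [ceil (n y)], with rows and
   columns numbered from 1; it is 0 on the null set where [x = 0] or [y = 0]. *)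
Definition graph_fun n (G : sgraph n) (z : R * R) : R :=
  [exists i, [exists j, [&& adj G i j, Num.ceil (n%:R * z.1) == i.+1 :> int
                          & Num.ceil (n%:R * z.2) == j.+1 :> int]]]%:R.

Definition crossing (p q : R * R) : Prop :=
  uniq [:: p.1; p.2; q.1; q.2] /\ chord p.1 p.2 `&` chord q.1 q.2 !=set0.

Record square_map := SquareMap {
  smap :> R -> R * R ;
  square_map_measurable : measurable_fun I01 smap ;
  square_map_itv : smap @` I01 `<=` I01 `*` I01 ;
  square_map_push : forall B, measurable B -> B `<=` I01 `*` I01 ->
    leb (I01 `&` smap @^-1` B) = (leb \x leb)%E B }.

Definition circle_fun (Psi : square_map) (z : R * R) : R :=
  `[< crossing (Psi z.1) (Psi z.2) >]%:R.

Lemma measurable_unit_square : measurable (I01 `*` I01).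
Proof. exact: measurableX. Qed.

Lemma measurable_natr_bool (b : R * R -> bool) :
  measurable ((I01 `*` I01) `&` [set z | b z]) ->
  measurable_fun (I01 `*` I01) (fun z => (b z)%:R : R).
Proof.
move=> mb.
apply: (@measurable_comp _ _ _ _ _ _ setT (fun c : bool => c%:R : R)) => //.
apply: (measurable_fun_bool true) => //.
Qed.

Lemma graph_fun_measurable n (G : sgraph n) :
  measurable_fun (I01 `*` I01) (graph_fun G).
Proof.
apply: measurable_natr_bool.
have mc (i : 'I_n) : measurable [set x : R | Num.ceil (n%:R * x) == i.+1 :> int].
  rewrite [X in measurable X](_ : _ =
    ( *%R (n%:R : R)) @^-1` `](i.+1%:Z - 1)%:~R, i.+1%:~R]); last first.
    by apply/seteqP; split => x /=; rewrite ceil_eq in_itv.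
  rewrite -[X in measurable X]setTI.
  by exact: (measurable_funM (measurable_cst _) (@measurable_id _ _ setT)).
apply: measurableI; first exact: measurable_unit_square.
rewrite [X in measurable X](_ : _ = \bigcup_(p in [set p : 'I_n * 'I_n | adj G p.1 p.2])
  ([set x : R | Num.ceil (n%:R * x) == p.1.+1 :> int] `*`
   [set x : R | Num.ceil (n%:R * x) == p.2.+1 :> int])); last first.
  apply/seteqP; split => [z /= /existsP[i /existsP[j /and3P[Gij zi zj]]]|z].
    by exists (i, j).
  by move=> [[i j] /= Gij [/= zi zj]]; apply/existsP; exists i; apply/existsP; exists j; apply/and3P.
apply: fin_bigcup_measurable => [|p _]; first exact: finite_finset.
by apply: measurableX.
Qed.

Lemma graph_fun_sym n (G : sgraph n) x y : graph_fun G (x, y) = graph_fun G (y, x).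
Proof.
rewrite /graph_fun; congr (nat_of_bool _)%:R; apply/idP/idP => /=.
  move=> /existsP[i /existsP[j /and3P[Gij zi zj]]]; apply/existsP; exists j; apply/existsP; exists i.
  apply/and3P; split => //.
  by have /andP[_ /forallP/(_ j)/forallP/(_ i)/eqP] := valP G; rewrite /adj => ->.
move=> /existsP[i /existsP[j /and3P[Gij zi zj]]]; apply/existsP; exists j; apply/existsP; exists i.
apply/and3P; split => //.
by have /andP[_ /forallP/(_ j)/forallP/(_ i)/eqP] := valP G; rewrite /adj => ->.
Qed.

Lemma bool_itv (b : bool) : 0 <= (b%:R : R) <= 1.
Proof. by case: b; rewrite ?lexx ?ler01. Qed.

Definition graph_graphon n (G : sgraph n) : graphon :=
  Graphon (graph_fun_measurable G) (fun x y _ _ => graph_fun_sym G x y)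
    (fun x y _ _ => bool_itv _).

Definition unlabeled_graphon n (u : ugraph n) : graphon :=
  graph_graphon (labeled u).

Lemma rat_dense01 (x e : R) : I01 x -> 0 < e ->
  exists2 q : rat, I01 (ratr q) & `|x - ratr q| < e.
Proof.
move=> /=; rewrite in_itv/= => /andP[x0 x1] e0.
have /rat_in_itvoo[q] : Num.max 0 (x - e) < Num.min 1 (x + e).
  by rewrite lt_min !gt_max -!andbA; apply/and4P; split; lra.
rewrite in_itv/= gt_max lt_min => /andP[/andP[q0 xq] /andP[q1 qx]].
exists q; first by rewrite /= in_itv/= !ltW.
by rewrite ltr_distlC; lra.
Qed.

Lemma measurable_ex_zero (D : set (R * R)) (F : R * R -> R * R -> R) :
  measurable D -> (forall z p, 0 <= F z p) -> (forall z, continuous (F z)) ->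
  (forall p, measurable_fun D (F ^~ p)) ->
  measurable (D `&` [set z | exists2 p, (I01 `*` I01) p & F z p = 0]).
Proof.
move=> mD F0 cF mF.
rewrite [X in measurable X](_ : _ = \bigcap_k \bigcup_(q : rat) \bigcup_(r : rat)
   (D `&` [set z | (I01 `*` I01) (ratr q, ratr r) /\ F z (ratr q, ratr r) < k.+1%:R^-1])).
  apply: bigcapT_measurable => k; apply: bigcupT_measurable_rat => q.
  apply: bigcupT_measurable_rat => r.
  have [qr|qr] := pselect ((I01 `*` I01) (ratr q : R, ratr r : R)).
    rewrite [X in measurable X](_ : _ =
      D `&` (F ^~ (ratr q, ratr r)) @^-1` `]-oo, k.+1%:R^-1[); first exact: mF.
    by apply/seteqP; split => z /=; rewrite in_itv/= => -[? //]; case.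
  rewrite [X in measurable X](_ : _ = set0) //.
  by apply/seteqP; split => z //= [_ []].
apply/seteqP; split => [z [Dz [p [/= p1 p2] Fp]] k _|z Dz].
  have : \forall p' \near p, F z p' < k.+1%:R^-1.
    by have := cF z p; rewrite /prop_for; move/cvgr_lt; apply; rewrite Fp invr_gt0.
  move=> /nbhs_ballP[e /= e0 be].
  have [q q01 pq] := rat_dense01 p1 e0.
  have [r r01 pr] := rat_dense01 p2 e0.
  by exists q => //; exists r => //; split => //; split => //; apply: be; split.
have [_ _ [_ _ [Dz' _]]] := Dz 0%N Logic.I; split => //.
have cI : compact (I01 `*` I01) by apply: compact_setX; exact: segment_compact.
have [||p /set_mem Ip pmin] := @compact_EVT_min _ R (F z) (I01 `*` I01) _ cI.
  by exists (0, 0); split; rewrite /= in_itv/= lexx ler01.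
  exact: continuous_subspaceT.
exists p => //; apply/eqP; rewrite eq_le F0 andbT; apply/ler_addgt0Pl => e e0.
rewrite addr0; have [k] := ltr_add_invr e0; rewrite add0r => ke.
have [q _ [r _ [_ [qr Fqr]]]] := Dz k Logic.I.
by apply: le_trans (ltW (lt_trans Fqr ke)); apply: pmin; apply/mem_set.
Qed.

Section circle_graphon.
Variable Psi : square_map.

Let seg (z : R * R) (t : R) : R * R := (1 - t) *: circle_pt z.1 + t *: circle_pt z.2.

Let gap (z p : R * R) : R :=
  `|(seg (Psi z.1) p.1).1 - (seg (Psi z.2) p.2).1| +
  `|(seg (Psi z.1) p.1).2 - (seg (Psi z.2) p.2).2|.

Let gap_ge0 z p : 0 <= gap z p. Proof. by rewrite addr_ge0. Qed.

Let gap_continuous z : continuous (gap z).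
Proof.
move=> p; rewrite /gap /seg /=.
apply: cvgD; apply: cvg_norm; apply: cvgB; apply: cvgD; apply: cvgMr_tmp.
all: try (apply: cvgB; first exact: cvg_cst).
all: try exact: cvg_fst.
all: exact: cvg_snd.
Qed.

Let measurable_Psi1 : measurable_fun (I01 `*` I01) (fun z : R * R => Psi z.1).
Proof.
apply: (@measurable_comp _ _ _ _ _ _ I01 Psi) => //.
- by move=> _ [z [z1 _] <-].
- exact: square_map_measurable.
- exact: measurable_funTS measurable_fst.
Qed.

Let measurable_Psi2 : measurable_fun (I01 `*` I01) (fun z : R * R => Psi z.2).
Proof.
apply: (@measurable_comp _ _ _ _ _ _ I01 Psi) => //.
- by move=> _ [z [_ z2] <-].
- exact: square_map_measurable.
- exact: measurable_funTS measurable_snd.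
Qed.

Let gap_measurable p : measurable_fun (I01 `*` I01) (gap ^~ p).
Proof.
have m11 := measurableT_comp measurable_fst measurable_Psi1.
have m12 := measurableT_comp measurable_snd measurable_Psi1.
have m21 := measurableT_comp measurable_fst measurable_Psi2.
have m22 := measurableT_comp measurable_snd measurable_Psi2.
have mt (f : R -> R) (g : R * R -> R) : continuous f ->
    measurable_fun (I01 `*` I01) g -> measurable_fun (I01 `*` I01) (fun z => f (2 * pi * g z)).
  move=> cf mg; apply: measurableT_comp; first exact: continuous_measurable_fun.
  by apply: measurable_funM => //; exact: measurable_cst.
rewrite /gap /seg /=; apply: measurable_funD; apply: measurableT_comp => //;
  apply: measurable_funB; apply: measurable_funD; apply: measurable_funM;
  try exact: measurable_cst; apply: mt => //; solve [exact: continuous_cos | exact: continuous_sin].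
Qed.

Lemma circle_fun_measurable : measurable_fun (I01 `*` I01) (circle_fun Psi).
Proof.
apply: measurable_natr_bool.
rewrite [X in measurable X](_ : _ =
  ((I01 `*` I01) `&` [set z | uniq [:: (Psi z.1).1; (Psi z.1).2; (Psi z.2).1; (Psi z.2).2]])
  `&` ((I01 `*` I01) `&` [set z | exists2 p, (I01 `*` I01) p & gap z p = 0])); last first.
  apply/seteqP; split => z /=.
    move=> [Iz /asboolP[uz [q [[s s01 sq] [t t01 tq]]]]]; split => //; split => //.
    exists (s, t) => //; rewrite /gap.
    have -> : seg (Psi z.1) s = seg (Psi z.2) t by rewrite /seg sq tq.
    by rewrite !subrr normr0 addr0.
  move=> [[Iz uz] [_ [[s t] [s01 t01] /eqP]]].
  rewrite paddr_eq0// !normr_eq0 !subr_eq0 => /andP[/eqP e1 /eqP e2].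
  split => //; apply/asboolP; split => //.
  exists (seg (Psi z.1) s); split; first by exists s.
  have pair_eq (p q : R * R) : p.1 = q.1 -> p.2 = q.2 -> p = q.
    by case: p q => ? ? [? ?] /= -> ->.
  by exists t => //; exact: (pair_eq (seg (Psi z.2) t) (seg (Psi z.1) s)).
apply: measurableI; last first.
  apply: measurable_ex_zero => //; exact: measurable_unit_square.
have m11 := measurableT_comp measurable_fst measurable_Psi1.
have m12 := measurableT_comp measurable_snd measurable_Psi1.
have m21 := measurableT_comp measurable_fst measurable_Psi2.
have m22 := measurableT_comp measurable_snd measurable_Psi2.
suff : measurable_fun (I01 `*` I01) (fun z : R * R =>
    uniq [:: (Psi z.1).1; (Psi z.1).2; (Psi z.2).1; (Psi z.2).2]).
  by move=> /(_ measurable_unit_square [set true]); exact.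
rewrite /= /in_mem /=.
by do ![apply: measurable_and|apply: measurable_neg|apply: measurable_or|apply: measurable_fun_eqr] => //;
  exact: measurable_cst.
Qed.

Lemma circle_fun_sym x y : circle_fun Psi (x, y) = circle_fun Psi (y, x).
Proof.
suff h (p q : R * R) : crossing p q -> crossing q p.
  by rewrite /circle_fun; congr (nat_of_bool _)%:R; apply: asbool_equiv_eq; split; exact: h.
move=> [u c]; split; last by rewrite setIC.
by rewrite -(@uniq_catC _ [:: p.1; p.2] [:: q.1; q.2]).
Qed.

Definition circle_graphon : graphon :=
  Graphon circle_fun_measurable (fun x y _ _ => circle_fun_sym x y)
    (fun x y _ _ => bool_itv _).

End circle_graphon.

End graphons.

(* Main.v *)
Require Import Defs.
From mathcomp Require Import all_boot all_order all_algebra all_fingroup.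
From mathcomp Require Import all_classical all_reals all_analysis.
From mathcomp Require Import measurable_realfun ring lra zify.

(** Why the theorem is true.  A circle graph on [n] vertices is the crossing graph
    of a chord diagram, that is of a bijection from the [2n] chord ends to the
    [2n] positions on the circle.  Two counts are compared, and the outcome is
    then read on the graphons.

    Most diagrams look uniform.  Cut the circle into [K] consecutive arcs and call
    a diagram balanced when, for a suitable cutting, each of the [K^2] ordered
    pairs of arcs carries about [n / K^2] chords.  Placing the [2n] ends in arcs by
    independent uniform letters and then ordering the ends inside each arc yields
    a uniform diagram, so that a Chernoff bound for words of independent letters
    shows that unbalanced diagrams form an exponentially small proportion of all
    [(2n)!] diagrams ([card_unbalanced], [card_sparse_words]).  A circle graph
    having no balanced diagram accounts for [n! 2^n] unbalanced ones, by
    permuting the chords and exchanging their ends ([card_unbalanced_graphs]).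

    Circle graphs are almost as numerous as diagrams up to relabelling.  The number
    of unlabelled circle graphs is only needed within a factor [exp (o(n))].
    Instead of proving that a typical circle graph has essentially one diagram,
    plant in the diagram a frame of [A] short chords, [A] being a large multiple of
    [sqrt n]: each of them encloses one arc, and the other chords have their ends in
    these arcs.  When no two of these other
    chords join the same pair of arcs, the adjacencies with the frame
    give the arcs of each chord, and the adjacency of two chords that share exactly
    one arc gives the order of their ends in it.  Thus the labelled graph determines
    the diagram up to a word recording in which arc each rank falls
    ([height_graph_inj]), which yields at least [exp (- o(n)) (2n)! / 2^n] labelled
    circle graphs ([card_circle_labelings_ge]), hence at least [1 / n!] times as many
    unlabelled ones.  The two counts show that the proportion of circle
    graphs without a balanced diagram decays exponentially
    ([unbalanced_graphs_rare]).

    Balanced diagrams are close to the limit.  Let [Psi] push the uniform law to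
    that of the square.  The preimages of the [K^2] blocks of the square have measure
    [1 / K^2]; up to a small error they are unions of the intervals of length [1 / n]
    attached to the vertices, and as the diagram is balanced, some permutation of
    these intervals sends nearly every vertex whose chord joins two given arcs into
    the preimage of the corresponding block.  When the four arcs of two chords are
    distinct, whether they cross can be read on the arcs alone, so that the two
    graphons agree outside of a set of measure [O(1 / K)] plus a small error
    ([balanced_cut_dist_le]).  Almost sure convergence is then the Borel-Cantelli
    lemma ([eventually_close]). *)

Set Implicit Arguments.
Unset Strict Implicit.
Unset Printing Implicit Defensive.

Import Order.TTheory GRing.Theory Num.Theory.
Import numFieldNormedType.Exports.

Local Open Scope classical_set_scope.
Local Open Scope ring_scope.

(** * Crossing chords *)

(** The parity of the number of comparisons from [{a, b}] to [{c, e}] that hold.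
    For four distinct points it is odd exactly when the two pairs interleave, and
    in this form its invariance under [a <-> b] and [c <-> e] is a computation. *)
Definition cross4 d (T : porderType d) (a b c e : T) : bool :=
  ((a < c)%O (+) (b < c)%O) (+) ((a < e)%O (+) (b < e)%O).

Lemma cross4_ltC d (T : orderType d) (a b c e : T) : uniq [:: a; b; c; e] ->
  cross4 a b c e = ((c < a)%O (+) (c < b)%O) (+) ((e < a)%O (+) (e < b)%O).
Proof.
rewrite /= !inE !negb_or andbT => /andP[/and3P[_ ac ae] /andP[/andP[bc be] _]].
rewrite /cross4; move: ac ae bc be.
by case: (ltgtP a c) => // _; case: (ltgtP a e) => // _;
  case: (ltgtP b c) => // _; case: (ltgtP b e).
Qed.

Lemma cross4_sym d (T : orderType d) (a b c e : T) : uniq [:: a; b; c; e] ->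
  cross4 a b c e = cross4 c e a b.
Proof. by move=> /cross4_ltC ->; rewrite /cross4; do !case: (_ < _)%O. Qed.

Section geometry.
Variable R : realType.
Implicit Types (a b c d t : R) (p q x y : R * R).

(** Twice the signed area of the triangle [p q x]: its sign tells on which side
    of the line [p q] the point [x] lies, and it is affine in [x]. *)
Definition side p q x : R :=
  (q.1 - p.1) * (x.2 - p.2) - (q.2 - p.2) * (x.1 - p.1).

(** Sum-to-product formulas.  As the sine is positive on the half turn, this
    turns the side of a chord on which a point lies into comparisons of angles. *)
Lemma side_circle a b t : side (circle_pt a) (circle_pt b) (circle_pt t) =
  4 * sin (pi * (b - a)) * sin (pi * (t - a)) * sin (pi * (t - b)).
Proof.
have C (u v : R) : cos (2 * pi * v) - cos (2 * pi * u) =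
    - 2 * sin (pi * (u + v)) * sin (pi * (v - u)).
  rewrite (_ : 2 * pi * v = pi * (u + v) + pi * (v - u)); last by ring.
  rewrite (_ : 2 * pi * u = pi * (u + v) - pi * (v - u)); last by ring.
  by rewrite cosD cosB; ring.
have S (u v : R) : sin (2 * pi * v) - sin (2 * pi * u) =
    2 * cos (pi * (u + v)) * sin (pi * (v - u)).
  rewrite (_ : 2 * pi * v = pi * (u + v) + pi * (v - u)); last by ring.
  rewrite (_ : 2 * pi * u = pi * (u + v) - pi * (v - u)); last by ring.
  by rewrite sinD sinB; ring.
rewrite /side /circle_pt /= !C !S.
rewrite (_ : pi * (t - b) = pi * (a + t) - pi * (a + b)); last by ring.
by rewrite [sin (_ - pi * (a + b))]sinB; ring.
Qed.

Lemma sin_pi_sign t : t != 0 -> `|t| < 1 ->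
  exists2 s, 0 < s & sin (pi * t) = (-1) ^+ (t < 0)%R * s.
Proof.
move=> t0 t1; exists (sin (pi * `|t|)).
  by apply: sin_gt0_pi; rewrite mulr_gt0 ?normr_gt0 ?pi_gt0//= gtr_pMr ?pi_gt0.
case: ltrgtP t0 => // t0 _; last by rewrite expr0 mul1r gtr0_norm.
by rewrite ltr0_norm// mulrN sinN expr1; ring.
Qed.

Lemma side_sign a b t : a != b -> t != a -> t != b ->
  `|b - a| < 1 -> `|t - a| < 1 -> `|t - b| < 1 ->
  exists2 s, 0 < s &
    side (circle_pt a) (circle_pt b) (circle_pt t) =
    (-1) ^+ ((b < a) (+) ((t < a) (+) (t < b))) * s.
Proof.
move=> ab ta tb hab hta htb; rewrite side_circle.
have ba : b - a != 0 by rewrite subr_eq0 eq_sym.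
have ta0 : t - a != 0 by rewrite subr_eq0.
have tb0 : t - b != 0 by rewrite subr_eq0.
have [s1 s1p ->] := sin_pi_sign ba hab.
have [s2 s2p ->] := sin_pi_sign ta0 hta.
have [s3 s3p ->] := sin_pi_sign tb0 htb.
exists (4 * (s1 * s2 * s3)); first by rewrite !mulr_gt0.
by rewrite !subr_lt0 !signr_addb; ring.
Qed.

Lemma side_seg p q x y t :
  side p q ((1 - t) *: x + t *: y) = (1 - t) * side p q x + t * side p q y.
Proof. by rewrite /side /= /GRing.scale/=; ring. Qed.

Lemma side_l p q : side p q p = 0. Proof. by rewrite /side; ring. Qed.
Lemma side_r p q : side p q q = 0. Proof. by rewrite /side; ring. Qed.

Lemma conv_same_sign u v t : 0 < u * v -> 0 <= t <= 1 -> (1 - t) * u + t * v != 0.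
Proof.
move=> uv /andP[t0 t1]; apply/eqP => h.
have := mulr_ge0 t0 t0; have u2 := sqr_ge0 u; have v2 := sqr_ge0 v.
have [u0|u0|u0] := ltrgtP u 0; have [v0|v0|v0] := ltrgtP v 0; nra.
Qed.

Lemma chord_disjoint a b p q :
  0 < side (circle_pt a) (circle_pt b) p * side (circle_pt a) (circle_pt b) q ->
  chord a b `&` [set (1 - t) *: p + t *: q | t in `[0, 1]] = set0.
Proof.
move=> h; apply/seteqP; split => // z [[s _ <-]] [t t01 tE].
have := side_seg (circle_pt a) (circle_pt b) p q t.
rewrite tE side_seg side_l side_r !mulr0 addr0.
by move/esym/eqP; rewrite (negPf (conv_same_sign h _))//; move: t01; rewrite /= in_itv.
Qed.

(** The two lines meet at the point dividing one segment in the ratio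
    [u' : - v'] and the other in the ratio [u : - v]; both ratios are positive. *)
Lemma seg_meet p1 q1 p2 q2 :
  side p1 q1 p2 * side p1 q1 q2 < 0 -> side p2 q2 p1 * side p2 q2 q1 < 0 ->
  [set (1 - t) *: p1 + t *: q1 | t in `[0, 1]] `&`
  [set (1 - t) *: p2 + t *: q2 | t in `[0, 1]] !=set0.
Proof.
set u := side p1 q1 p2; set v := side p1 q1 q2.
set u' := side p2 q2 p1; set v' := side p2 q2 q1 => uv uv'.
have D0 : u - v != 0.
  by rewrite subr_eq0; apply: contraTneq uv => ->; rewrite -leNgt -expr2 sqr_ge0.
have E : u - v = v' - u' by rewrite /u /v /u' /v' /side; ring.
have D0' : u' - v' != 0 by rewrite -opprB -E oppr_eq0.
have I (x y : R) : x * y < 0 -> 0 <= x / (x - y) <= 1.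
  move=> xy0.
  have [x0|x0|x0] := ltrgtP x 0; have [y0|y0|y0] := ltrgtP y 0; try nra.
    apply/andP; split; last by rewrite ler_ndivrMr; lra.
    by rewrite mulr_le0// ?ltW// invr_lt0; lra.
  apply/andP; split; first by rewrite divr_ge0; lra.
  by rewrite ler_pdivrMr; lra.
exists ((1 - u' / (u' - v')) *: p1 + (u' / (u' - v')) *: q1); split.
  by exists (u' / (u' - v')) => //=; rewrite in_itv; apply: I.
exists (u / (u - v)); first by rewrite /= in_itv; apply: I.
rewrite [LHS]surjective_pairing [RHS]surjective_pairing; congr pair => /=; rewrite /GRing.scale/=.
  rewrite -(opprB v' u') -E; move: D0; rewrite /u /v /u' /side => D.
  by field.
rewrite -(opprB v' u') -E; move: D0; rewrite /u /v /u' /side => D.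
by field.
Qed.

(** If the pairs interleave, each chord separates the ends of the other;
    otherwise both ends of one chord lie strictly on the same side of the other.
    The bound on the differences excludes the angles [0] and [1], which are distinct
    reals but the same point of the circle. *)
Lemma chord_meet a b c d : uniq [:: a; b; c; d] ->
  {in [:: a; b; c; d] &, forall u v : R, `|u - v| < 1} ->
  (chord a b `&` chord c d !=set0) <-> cross4 a b c d.
Proof.
move=> uabcd near; have /= := uabcd; rewrite !inE !negb_or andbT.
move=> /andP[/and3P[ab ac ad] /andP[/andP[bc bd] cd]].
have [ba ca da] : [/\ b != a, c != a & d != a] by split; rewrite eq_sym.
have [cb db dc] : [/\ c != b, d != b & d != c] by split; rewrite eq_sym.
have n (x y : R) : x \in [:: a; b; c; d] -> y \in [:: a; b; c; d] -> `|x - y| < 1 by exact: near.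
have [s1 s1p e1] : exists2 s, 0 < s & side (circle_pt a) (circle_pt b) (circle_pt c) =
    (-1) ^+ ((b < a) (+) ((c < a) (+) (c < b))) * s.
  by apply: side_sign => //; apply: n; rewrite !inE eqxx ?orbT.
have [s2 s2p e2] : exists2 s, 0 < s & side (circle_pt a) (circle_pt b) (circle_pt d) =
    (-1) ^+ ((b < a) (+) ((d < a) (+) (d < b))) * s.
  by apply: side_sign => //; apply: n; rewrite !inE eqxx ?orbT.
have [s3 s3p e3] : exists2 s, 0 < s & side (circle_pt c) (circle_pt d) (circle_pt a) =
    (-1) ^+ ((d < c) (+) ((a < c) (+) (a < d))) * s.
  by apply: side_sign => //; apply: n; rewrite !inE eqxx ?orbT.
have [s4 s4p e4] : exists2 s, 0 < s & side (circle_pt c) (circle_pt d) (circle_pt b) =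
    (-1) ^+ ((d < c) (+) ((b < c) (+) (b < d))) * s.
  by apply: side_sign => //; apply: n; rewrite !inE eqxx ?orbT.
have P12 : side (circle_pt a) (circle_pt b) (circle_pt c) *
    side (circle_pt a) (circle_pt b) (circle_pt d) = (-1) ^+ (cross4 a b c d) * (s1 * s2).
  rewrite cross4_ltC// e1 e2 mulrACA -signr_addb; congr ((-1) ^+ _ * _).
  by do !case: (_ < _).
have P34 : side (circle_pt c) (circle_pt d) (circle_pt a) *
    side (circle_pt c) (circle_pt d) (circle_pt b) = (-1) ^+ (cross4 a b c d) * (s3 * s4).
  rewrite e3 e4 mulrACA -signr_addb; congr ((-1) ^+ _ * _).
  by rewrite /cross4; do !case: (_ < _).
case: (cross4 a b c d) P12 P34 => P12 P34; split => //; last first.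
  move=> h; suff /seteqP[/(_ _)] : chord a b `&` chord c d = set0.
    by case: h => x hx /(_ x hx).
  by apply: chord_disjoint; rewrite P12 expr0 mul1r mulr_gt0.
by move=> _; apply: seg_meet; rewrite ?P12 ?P34 expr1 mulN1r oppr_lt0 mulr_gt0.
Qed.

End geometry.

(** * Labelled circle graphs as chord diagrams *)

Lemma cross4_flip d (T : porderType d) (b1 b2 : bool) (x y : bool -> T) :
  cross4 (x b1) (x (~~ b1)) (y b2) (y (~~ b2)) = cross4 (x false) (x true) (y false) (y true).
Proof. by rewrite /cross4; case: b1; case: b2 => /=; do !case: (_ < _)%O. Qed.

Section labeled_circle_graphs.
Variable n : nat.
Implicit Types (e : 'I_n * bool -> nat) (G H : sgraph n).
Implicit Types f : {ffun 'I_n * bool -> 'I_(n.*2)}.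

Definition height_adj e : rel 'I_n := fun i j =>
  (i != j) && cross4 (e (i, false)) (e (i, true)) (e (j, false)) (e (j, true)).

Definition height_mx e : 'M[bool]_n := (\matrix_(i, j) height_adj e i j)%R.

Lemma edgeless_simple : simple_adj (const_mx false : 'M[bool]_n).
Proof. by apply/andP; split; apply/forallP => i; [|apply/forallP => j]; rewrite !mxE. Qed.

(** Only the relative order of the heights of the chord ends [(i, b)] matters, so
    that diagrams can be described with gaps between the ends.  For injective
    heights the matrix is symmetric and the default value is not reached. *)
Definition height_graph e : sgraph n :=
  insubd (Sub (const_mx false) edgeless_simple : sgraph n) (height_mx e).

Lemma uniq_heights e i j (b1 b2 : bool) : injective e -> i != j ->
  uniq [:: e (i, b1); e (i, ~~ b1); e (j, b2); e (j, ~~ b2)].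
Proof.
move=> ie ij.
rewrite -[X in uniq X]/(map e [:: (i, b1); (i, ~~ b1); (j, b2); (j, ~~ b2)]).
rewrite map_inj_uniq//= !inE !xpair_eqE (negPf ij) !eqxx /=.
by case: b1; case: b2.
Qed.

Lemma adj_height_graph e : injective e -> adj (height_graph e) =2 height_adj e.
Proof.
move=> ie i j; rewrite /adj val_insubd ifT ?mxE//.
apply/andP; split; apply/forallP => k; first by rewrite !mxE /height_adj eqxx.
apply/forallP => l; rewrite !mxE /height_adj (eq_sym l); case: (eqVneq k l) => //= lk.
by apply/eqP/cross4_sym; exact: (uniq_heights false false).
Qed.

Lemma sgraph_eq G H : adj G =2 adj H -> G = H.
Proof. by move=> GH; apply/val_inj/matrixP => i j; exact: GH. Qed.

Lemma height_graph_mono e e' : injective e ->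
  (forall x y, (e x < e y)%N = (e' x < e' y)%N) -> height_graph e = height_graph e'.
Proof.
move=> ie ee'; have ie' : injective e'.
  move=> x y xy; apply: ie.
  by case: (ltngtP (e x) (e y)) => //; rewrite ee' xy ltnn.
apply: sgraph_eq => i j; rewrite !adj_height_graph// /height_adj.
by rewrite /cross4 !ltEnat /= !ee'.
Qed.

(** The rank of an end is the number of ends below it. *)
Lemma rank_heights e : injective e -> exists2 f : {ffun 'I_n * bool -> 'I_(n.*2)},
  injective f & forall x y, (f x < f y)%N = (e x < e y)%N.
Proof.
move=> ie; pose r x := #|[set y | (e y < e x)%N]%SET|.
have r_lt x : (r x < n.*2)%N.
  have -> : n.*2 = #|{: 'I_n * bool}| by rewrite card_prod card_ord card_bool muln2.
  rewrite -cardsT; apply: proper_card; apply/properP; split; first exact: finset.subsetT.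
  by exists x; rewrite !inE ?ltnn.
have r_mono x y : (e x < e y)%N -> (r x < r y)%N.
  move=> xy; apply: proper_card; apply/properP; split.
    by apply/fintype.subsetP => z; rewrite !inE => zx; exact: ltn_trans xy.
  by exists x; rewrite !inE ?ltnn.
have mono x y : (r x < r y)%N = (e x < e y)%N.
  case: (ltngtP (e x) (e y)) => [/r_mono//|/r_mono xy|/ie ->]; last exact: ltnn.
  by apply/negbTE; rewrite -leqNgt ltnW.
exists [ffun x => Ordinal (r_lt x)] => [x y|x y]; last by rewrite !ffunE /= mono.
rewrite !ffunE => -[rxy]; apply: ie.
by case: (ltngtP (e x) (e y)) => //; rewrite -mono rxy ltnn.
Qed.

Definition diagrams : {set {ffun 'I_n * bool -> 'I_(n.*2)}} :=
  [set f : {ffun 'I_n * bool -> 'I_(n.*2)} | injectiveb f]%SET.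

Lemma card_diagrams : #|diagrams| = (n.*2)`!.
Proof. by rewrite card_inj_ffuns card_prod !card_ord card_bool muln2 ffactnn. Qed.

Definition diagram_graph (f : {ffun 'I_n * bool -> 'I_(n.*2)}) : sgraph n :=
  height_graph (fun x => f x).

Lemma diagramP f : reflect (injective f) (f \in diagrams).
Proof. by rewrite inE; exact: injectiveP. Qed.

Lemma diagram_heights f : f \in diagrams -> injective (fun x => f x : nat).
Proof. by move=> /diagramP fi x y /val_inj/fi. Qed.

Lemma adj_diagram f i j : f \in diagrams -> i != j -> forall b1 b2 : bool,
  adj (diagram_graph f) i j =
    cross4 (f (i, b1)) (f (i, ~~ b1)) (f (j, b2)) (f (j, ~~ b2)).
Proof.
move=> fd ij b1 b2; rewrite adj_height_graph; last exact: diagram_heights.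
rewrite /height_adj ij /=.
by rewrite (cross4_flip b1 b2 (fun b => f (i, b)) (fun b => f (j, b))).
Qed.

Variable R : realType.

Lemma chord_of_meet (p : 'I_(n.*2) * 'I_(n.*2)) (q : 'I_(n.*2) * 'I_(n.*2)) :
  uniq [:: p.1; p.2; q.1; q.2] ->
  `[< chord (matching_pt R p.1) (matching_pt R p.2) `&`
      chord (matching_pt R q.1) (matching_pt R q.2) !=set0 >] = cross4 p.1 p.2 q.1 q.2.
Proof.
move=> upq.
have n0 : (0 < n.*2)%N by case: p.1 => x; exact: leq_ltn_trans.
have n0R : 0 < (n.*2)%:R :> R by rewrite ltr0n.
have lt_pt (i j : 'I_(n.*2)) : (matching_pt R i < matching_pt R j) = (i < j)%N.
  by rewrite /matching_pt ltr_pM2r ?invr_gt0// ltr_nat ltnS.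
have pt01 (i : 'I_(n.*2)) : 0 < matching_pt R i <= 1.
  by rewrite /matching_pt divr_gt0 ?ltr0n//= ler_pdivrMr// mul1r ler_nat.
have pt_inj : injective (@matching_pt R n).
  move=> i j ij; apply: val_inj.
  by case: (ltngtP (val i) (val j)) => //; rewrite -lt_pt ij ltxx.
rewrite [RHS](_ : _ = cross4 (matching_pt R p.1) (matching_pt R p.2)
  (matching_pt R q.1) (matching_pt R q.2)); last by rewrite /cross4 !lt_pt.
have upt : uniq [seq matching_pt R i | i <- [:: p.1; p.2; q.1; q.2]].
  by rewrite (map_inj_uniq pt_inj).
have [|m c] := chord_meet upt; last by apply/asboolP/idP.
have mem z : z \in map (@matching_pt R n) [:: p.1; p.2; q.1; q.2] -> 0 < z <= 1.
  by move=> /mapP[i _ ->].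
by move=> x y /mem hx /mem hy; rewrite ltr_norml; lra.
Qed.

(** The isomorphism from the graph to the chords is used to name the chords, so
    that the labelled graph itself is recovered, not only its isomorphism class. *)
Lemma circle_diagram (u : ugraph n) : circle_graph R u ->
  exists2 f, f \in diagrams & labeled u = diagram_graph f.
Proof.
move=> [m [mK mm] [h [hb hE]]].
pose f := [ffun x : 'I_n * bool => if x.2 then m (val (h x.1)) else val (h x.1)].
have hlt i := valP (h i); have hinj := bij_inj hb.
have mne i j : val (h i) <> m (val (h j)).
  move=> e; have := hlt i; rewrite /= e mK ltnNge.
  by have := hlt j; rewrite /= => /ltnW ->.
have fi : injective f.
  move=> [i [|]] [j [|]]; rewrite !ffunE /=.
  - by move/(can_inj mK)/val_inj/hinj => ->.
  - by move/esym/mne.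
  - by move/mne.
  - by move/val_inj/hinj => ->.
have fd : f \in diagrams by apply/diagramP.
exists f => //; apply: sgraph_eq => i j; rewrite hE /chord_adj.
case: (eqVneq i j) => [->|ij].
  by rewrite eqxx adj_height_graph /height_adj ?eqxx//; exact: diagram_heights.
rewrite (adj_diagram fd ij false false) (inj_eq hinj) ij /= /chord_of.
have := @chord_of_meet (f (i, false), f (i, true)) (f (j, false), f (j, true)).
rewrite /= !ffunE /=; apply.
have := uniq_heights false false (diagram_heights fd) ij.
by rewrite -[X in uniq X -> _]/(map val [:: f (i, false); f (i, true); f (j, false); f (j, true)])
  (map_inj_uniq val_inj) !ffunE /=.
Qed.

Lemma diagram_circle (u : ugraph n) f : f \in diagrams ->
  isob (labeled u) (diagram_graph f) -> circle_graph R u.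
Proof.
move=> fd /asboolP[k [kb kE]]; have fi := elimT (diagramP f) fd.
have [g fK gK] : bijective f.
  by apply: inj_card_bij => //; rewrite card_prod !card_ord card_bool muln2.
pose m x := f ((g x).1, ~~ (g x).2).
have mf i b : m (f (i, b)) = f (i, ~~ b) by rewrite /m fK.
pose s i := (f (i, true) < f (i, false))%N.
have slt i : (f (i, s i) < m (f (i, s i)))%N.
  rewrite mf /s; case: (ltngtP (f (i, true)) (f (i, false))) => //=.
  by move/val_inj/fi => [].
pose h i : chord_index m := exist _ (f (i, s i)) (slt i).
have hb : bijective h.
  exists (fun c => (g (val c)).1) => [i|[c]]; first by rewrite /= fK.
  rewrite -(gK c); case: (g c) => i b clt; apply: val_inj => /=.
  rewrite fK /=; move: clt; rewrite mf => lt; congr (f (_, _)); rewrite /s.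
  by case: b lt => //= lt; apply/negbTE; rewrite -leqNgt ltnW.
exists m.
  split=> [x|x]; first by rewrite /m fK /= negbK -surjective_pairing gK.
  rewrite /m; apply/eqP => e; have := congr1 g e; rewrite fK.
  by case: (g x) => i [].
exists (h \o k); split; first exact: bij_comp.
move=> x y; rewrite kE /=; move: (k x) (k y) => i j {x y kE}.
rewrite /chord_adj (inj_eq (bij_inj hb)); case: (eqVneq i j) => [->|ij] /=.
  by rewrite adj_height_graph /height_adj ?eqxx//; exact: diagram_heights.
rewrite (adj_diagram fd ij (s i) (s j)) /chord_of /= !mf.
symmetry; apply: (@chord_of_meet (f (i, s i), f (i, ~~ s i)) (f (j, s j), f (j, ~~ s j))).
have := uniq_heights (s i) (s j) (diagram_heights fd) ij.
by rewrite -[X in uniq X -> _]/(map val [:: f (i, s i); f (i, ~~ s i); f (j, s j); f (j, ~~ s j)])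
  (map_inj_uniq val_inj).
Qed.

End labeled_circle_graphs.

(** * A lower bound on the number of labelled circle graphs *)

Lemma ltn_lex (W I J r s : nat) : (r < W)%N -> (s < W)%N ->
  (I * W + r < J * W + s)%N = (I < J)%N || ((I == J) && (r < s)%N).
Proof.
move=> rW sW; case: (ltngtP I J) => [IJ|JI|->] /=.
- have := leq_mul IJ (leqnn W); rewrite mulSn; lia.
- by have := leq_mul JI (leqnn W); rewrite mulSn => ?; apply/negbTE; lia.
- by rewrite ltn_add2l.
Qed.

(** On each fibre of [a] both permutations run increasingly through the same
    places.  At the lowest place where they differ, this order forces [g] to send
    the point to a still lower place, but there the two permutations agree. *)
Lemma monotone_word_inj (X : finType) (B : Type) (w : X -> B) (a : X -> B)
    (h : X -> nat) (f g : {perm X}) : injective h ->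
  (forall x, w (f x) = a x) -> (forall x, w (g x) = a x) ->
  (forall x y, a x = a y -> (h (f x) < h (f y))%N = (h (g x) < h (g y))%N) -> f = g.
Proof.
move=> hi wf wg fg; apply/permP => x0; apply/eqP/negPn/negP => x0P.
have := @arg_minnP _ x0 (fun x => f x != g x) (fun x => h (f x)) x0P.
case: arg_minnP => // x fgx xmin _.
set y := (g^-1)%g (f x); have gy : g y = f x by rewrite /y permKV.
have yx : y != x by apply: contraNneq fgx => yx; rewrite -gy yx.
have fgy : f y != g y by rewrite gy (inj_eq perm_inj).
have ay : a x = a y by rewrite -wf -wg gy.
have xy : (h (f x) < h (f y))%N.
  by rewrite ltn_neqAle xmin // andbT (inj_eq hi) (inj_eq perm_inj) eq_sym.
set z := (f^-1)%g (g x); have fz : f z = g x by rewrite /z permKV.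
have gx : (h (g x) < h (f x))%N by rewrite -gy -fg.
have /negPn/eqP gz : ~~ (f z != g z).
  by apply/negP => /xmin; rewrite fz leqNgt gx.
have zx : z = x by apply: (@perm_inj _ g); rewrite -gz.
by move: fgx; rewrite -fz zx eqxx.
Qed.

Lemma card_perm_type (T : finType) : #|{perm T}| = (#|T|)`!.
Proof.
rewrite -[in RHS]cardsT -card_perm; apply: eq_card => s; rewrite !inE.
by apply/esym/fintype.subsetP => z; rewrite inE.
Qed.

Section many_labeled_graphs.
Variables A N : nat.
Implicit Types (a : {ffun 'I_N -> 'I_A * 'I_A}) (r : {perm ('I_N * bool)%type}).
Implicit Types (x y : 'I_N * bool).

Definition arc a x : 'I_A := if x.2 then (a x.1).2 else (a x.1).1.

Arguments arc : simpl never.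

Definition width := (#|{: 'I_N * bool}|.+2)%N.

(** Vertex [i] of the first [A] is a frame chord, from one end of the [i]-th
    window of [width] consecutive heights to the other.  The remaining ends lie
    strictly inside the windows, in the window [arc a x] and in the order
    given by [r]. *)
Definition height a r (z : 'I_(A + N) * bool) : nat :=
  match fintype.split z.1 with
  | inl i => i * width + (if z.2 then width.-1 else 0)
  | inr v => arc a (v, z.2) * width + (enum_rank (r (v, z.2))).+1
  end.

Definition place a r x : nat := arc a x * width + (enum_rank (r x)).+1.

Lemma height_frame a r (i : 'I_A) b :
  height a r (lshift N i, b) = (i * width + (if b then width.-1 else 0))%N.
Proof. by rewrite /height /= (unsplitK (inl i)). Qed.

Lemma height_place a r (v : 'I_N) b : height a r (rshift A v, b) = place a r (v, b).
Proof. by rewrite /height /= (unsplitK (inr v)). Qed.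

Lemma place_lt a r x y : (place a r x < place a r y)%N =
  (arc a x < arc a y)%N || ((arc a x == arc a y) && (enum_rank (r x) < enum_rank (r y))%N).
Proof. by rewrite ltn_lex // /width !ltnS ltnW. Qed.

Lemma frame_place_lt a r (i : 'I_A) b x :
  (height a r (lshift N i, b) < place a r x)%N =
  if b then (i < arc a x)%N else (i <= arc a x)%N.
Proof.
rewrite height_frame ltn_lex //; last by rewrite /width !ltnS ltnW.
- case: b; last by rewrite [RHS]leq_eqVlt andbT orbC.
  by rewrite /width /= ltnS [(_ < enum_rank _)%N]ltnNge [(enum_rank _ <= _)%N]ltnW// andbF orbF.
- by case: b.
Qed.

Lemma height_inj a r : injective (height a r).
Proof.
have W0 : (0 < width)%N by [].
have fr i b x : height a r (lshift N i, b) <> place a r x.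
  rewrite height_frame /place => /eqP; rewrite -[_ == _]negbK neq_ltn.
  have rk : ((enum_rank (r x)).+1 < width)%N by rewrite /width !ltnS ltnW.
  have bW : ((if b then width.-1 else 0) < width)%N by case: b.
  rewrite !ltn_lex// (eq_sym (val (arc a x))).
  case: ltngtP => //= _; rewrite -neq_ltn negbK; case: b bW => // _.
  rewrite /width /= => /eqP[] /eqP; rewrite gtn_eqF//.
move=> [u b] [v c]; case: (split_ordP u) => i ->; case: (split_ordP v) => j -> //.
- rewrite !height_frame => /eqP; rewrite -[_ == _]negbK neq_ltn.
  have bW (d : bool) : ((if d then width.-1 else 0) < width)%N by case: d.
  rewrite !ltn_lex// (eq_sym (val j)).
  case: (ltngtP i j) => //= /val_inj -> ; rewrite -neq_ltn negbK.
  by case: b; case: c.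
- by rewrite height_place => /fr.
- by rewrite height_place => /esym/fr.
- rewrite !height_place => /eqP; rewrite -[_ == _]negbK neq_ltn !place_lt.
  rewrite (eq_sym (arc a (j, c))).
  case: (ltngtP (arc a (i, b)) (arc a (j, c))) => //= [_|e]; [by rewrite orbT|rewrite (val_inj e)].
  by rewrite eqxx -neq_ltn negbK => /eqP/val_inj/enum_rank_inj/perm_inj[-> ->].
Qed.

(** The chord [v] goes from arc [(a v).1] to arc [(a v).2].  Forbidding two chords to
    join the same arcs makes the order inside every arc visible in the graph, and
    only costs a factor [(1 - O(1 / A + N / A ^ 2)) ^ N] in the number of families. *)
Definition distinct_shapes : {set {ffun 'I_N -> 'I_A * 'I_A}} :=
  [set a : {ffun 'I_N -> 'I_A * 'I_A} |
    (a \in ffun_on [pred p : 'I_A * 'I_A | (p.1 < p.2)%N]) && injectiveb a]%SET.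

Lemma distinct_shapesP a : a \in distinct_shapes -> injective a /\ forall v, ((a v).1 < (a v).2)%N.
Proof. by rewrite inE => /andP[/ffun_onP h /injectiveP]. Qed.

Lemma card_increasing_pairs : #|[pred p : 'I_A * 'I_A | (p.1 < p.2)%N]| = 'C(A, 2).
Proof.
rewrite -bin2_sum big_mkord -sum1_card.
rewrite -(pair_big_dep xpredT (fun i j : 'I_A => (i < j)%N) (fun _ _ => 1%N)) /=.
rewrite (exchange_big_dep xpredT) //=; apply: eq_bigr => j _.
rewrite sum1_card.
have wi : injective (widen_ord (ltnW (ltn_ord j))) by move=> x y /(congr1 val) /= /val_inj.
rewrite -[RHS](card_ord j) -(card_imset predT wi).
apply: eq_card => i; rewrite unfold_in; apply/idP/imsetP => [ij|[k _ ->]]; last exact: (ltn_ord k).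
by exists (Ordinal ij) => //; exact: val_inj.
Qed.

Lemma card_distinct_shapes : #|distinct_shapes| = 'C(A, 2) ^_ N.
Proof.
rewrite cardsE -card_increasing_pairs -[in RHS](card_ord N) -card_inj_ffuns_on.
by apply: eq_card => a; rewrite !inE.
Qed.

(** A chord crosses the frame chord around an arc when exactly one of its ends is
    in that arc; this is how the graph shows which arcs a chord joins. *)
Lemma adj_frame a r (i : 'I_A) (v : 'I_N) :
  adj (height_graph (height a r)) (lshift N i) (rshift A v) =
  (i == (a v).1) (+) (i == (a v).2).
Proof.
rewrite adj_height_graph; last exact: height_inj.
rewrite /height_adj eq_lrshift /= !height_place /cross4 !ltEnat /= !frame_place_lt /arc /=.
by rewrite -!val_eqE /=; case: (ltngtP i (a v).1); case: (ltngtP i (a v).2).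
Qed.

Lemma arc_flip_neq a x y : a \in distinct_shapes -> x.1 != y.1 -> arc a x = arc a y ->
  arc a (x.1, ~~ x.2) != arc a (y.1, ~~ y.2).
Proof.
move=> /distinct_shapesP[ai alt] xy axy; apply: contraNneq xy.
case: x y axy => v [] [w []]; rewrite /arc /= => e e'.
- by apply/eqP/ai; rewrite (surjective_pairing (a v)) e e' -surjective_pairing.
- by have := alt v; have := alt w; rewrite e -e' => /ltnW; rewrite leqNgt => /negP.
- by have := alt v; have := alt w; rewrite e -e' => /ltnW; rewrite leqNgt => /negP.
- by apply/eqP/ai; rewrite (surjective_pairing (a v)) e e' -surjective_pairing.
Qed.

(** The other ends of the two chords are in different arcs, and so three of the four
    comparisons only depend on the arcs; the adjacency gives the fourth one. *)
Lemma adj_same_arc a r x y : a \in distinct_shapes -> x.1 != y.1 -> arc a x = arc a y ->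
  adj (height_graph (height a r)) (rshift A x.1) (rshift A y.1) =
  (enum_rank (r x) < enum_rank (r y))%N (+)
  (((arc a (x.1, ~~ x.2) < arc a y)%N (+) (arc a x < arc a (y.1, ~~ y.2))%N) (+)
   (arc a (x.1, ~~ x.2) < arc a (y.1, ~~ y.2))%N).
Proof.
move=> an xy axy; have afl := arc_flip_neq an xy axy.
have [_ alt] := distinct_shapesP an.
have flip z : arc a (z.1, ~~ z.2) != arc a z.
  have := alt z.1; rewrite /arc; case: z => ? [] /=; rewrite ltn_neqAle => /andP[] //.
  by rewrite eq_sym.
rewrite adj_height_graph; last exact: height_inj.
rewrite /height_adj eq_rshift xy /= !height_place.
rewrite -(cross4_flip x.2 y.2 (fun b => place a r (x.1, b)) (fun b => place a r (y.1, b))).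
rewrite -!surjective_pairing /cross4 !ltEnat /= !place_lt (negPf afl).
have := flip x; rewrite axy => /negPf ->; have := flip y; rewrite eq_sym => /negPf ->.
by rewrite ltnn eqxx !orbF /= -!addbA; congr (_ (+) _); rewrite addbA.
Qed.

(** The arc in which each rank falls.  Inside an arc the graph knows the order of the
    ends, so this word is all that it misses about [r]. *)
Definition word a r : {ffun 'I_N * bool -> 'I_A} := [ffun p => arc a ((r^-1)%g p)].

Lemma height_graph_inj a a' r r' : a \in distinct_shapes -> a' \in distinct_shapes ->
  height_graph (height a r) = height_graph (height a' r') ->
  word a r = word a' r' -> a = a' /\ r = r'.
Proof.
move=> an an' eG ew; have [ai alt] := distinct_shapesP an; have [ai' alt'] := distinct_shapesP an'.
have aa' : a = a'.
  apply/ffunP => v; have /= := alt v; have /= := alt' v.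
  have E i : (i == (a v).1) (+) (i == (a v).2) = (i == (a' v).1) (+) (i == (a' v).2).
    by rewrite -(adj_frame a r) -(adj_frame a' r') eG.
  case: (a v) (a' v) E => [i j] [i' j'] /= E lt' lt.
  have := E i; have := E j; have := E i'; have := E j'; rewrite !eqxx.
  rewrite -!val_eqE /= (ltn_eqF lt) (gtn_eqF lt) (ltn_eqF lt') (gtn_eqF lt').
  move=> h1 h2 h3 h4; congr pair; apply: val_inj => /=; lia.
split => //; rewrite -{}aa' in ew eG *.
have w1 x : word a r (r x) = arc a x by rewrite ffunE permK.
have w2 x : word a r (r' x) = arc a x by rewrite ew ffunE permK.
apply: (monotone_word_inj (h := fun x => enum_rank x)) w1 w2 _ => [x y|x y axy].
  by move/val_inj/enum_rank_inj.
have [xy|xy] := eqVneq x.1 y.1.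
  have -> : x = y.
    move: xy axy; case: x => v b; case: y => w c /= ->; have := alt w.
    by rewrite /arc; case: b; case: c => //= lt e; move: lt; rewrite e ltnn.
  by rewrite !ltnn.
have := congr1 (fun G => adj G (rshift A x.1) (rshift A y.1)) eG.
by rewrite !adj_same_arc// => /addIb.
Qed.

Definition circle_labelings n : {set sgraph n} :=
  [set diagram_graph f | f in diagrams n]%SET.

(** There are at most [A ^ (2N)] words, whereas the [(2N)!] orders [r] and the
    families [a] are recovered from the graph together with the word. *)
Lemma card_circle_labelings :
  ('C(A, 2) ^_ N * (N.*2)`! <= #|circle_labelings (A + N)| * A ^ N.*2)%N.
Proof.
have -> : (N.*2 = #|{: 'I_N * bool}|)%N by rewrite card_prod card_ord card_bool muln2.
rewrite -[X in (_ <= _ * X ^ _)%N]card_ord -card_ffun -card_distinct_shapes.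
rewrite -card_perm_type.
rewrite -cardsT -[X in (_ <= _ * X)%N]cardsT -!cardsX.
pose F ar := (height_graph (height ar.1 ar.2), word ar.1 ar.2).
rewrite -(card_in_imset (f := F)) => [|[a r] [a' r']]; last first.
  move=> /setXP[an _] /setXP[an' _] [eG ew].
  by have [-> ->] := height_graph_inj an an' eG ew.
apply: subset_leq_card; apply/fintype.subsetP => _ /imsetP[[a r] _ ->].
rewrite finset.in_setX finset.in_setT andbT; have [f fi fE] := rank_heights (@height_inj a r).
apply/imsetP; exists f; first exact/diagramP.
by apply: height_graph_mono => //; exact: height_inj.
Qed.

End many_labeled_graphs.

(** * Words with an underrepresented letter *)

Section chernoff.
Variables (R : realType) (B : finType) (n : nat).
Local Notation b := (#|B|%:R : R).

Lemma expRN_le (l : R) : 0 <= l -> expR (- l) <= 1 - l + l ^+ 2.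
Proof.
move=> l0; have e := expR_ge1Dx l; have p : 0 < 1 + l by lra.
apply: (@le_trans _ _ (1 + l)^-1); first by rewrite expRN lef_pV2// posrE expR_gt0.
by rewrite -[leLHS]mul1r ler_pdivrMr//; have := exprn_ge0 3 l0; nra.
Qed.

Definition occurrences (x : {ffun 'I_n -> B}) (t : B) : nat := #|[set i | x i == t]%SET|.

Lemma sum_exp_occurrences (t : B) (l : R) :
  \sum_(x : {ffun 'I_n -> B}) expR (- l * (occurrences x t)%:R) =
  (b - 1 + expR (- l)) ^+ n.
Proof.
transitivity (\sum_(x : {ffun 'I_n -> B}) \prod_(i < n) (if x i == t then expR (- l) else 1)).
  apply: eq_bigr => x _; rewrite -big_mkcond /= prodr_const expRM_natr.
  by rewrite /occurrences cardsE.
rewrite -(bigA_distr_bigA (fun (_ : 'I_n) j => if j == t then expR (- l) else 1)) /=.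
rewrite prodr_const card_ord (bigD1 t)//= eqxx.
rewrite (eq_bigr (fun=> 1)) => [|i /negPf -> //].
have -> : b = (\sum_(i : B) 1 : R) by rewrite sumr_const.
by rewrite [in RHS](bigD1 t)//= addrC; congr (_ ^+ _); ring.
Qed.

Definition sparse_words (e : R) : {set {ffun 'I_n -> B}} :=
  [set x : {ffun 'I_n -> B} | [exists t, (occurrences x t)%:R < (b^-1 - e) * n%:R]]%SET.

Definition rare_words (e : R) (t : B) : {set {ffun 'I_n -> B}} :=
  [set x : {ffun 'I_n -> B} | (occurrences x t)%:R < (b^-1 - e) * n%:R]%SET.

(** Markov's inequality for [exp (- l * occurrences)] with [l = e / 2], which is
    the value minimising the bound [l ^+ 2 - l * e] on the exponent. *)
Lemma card_rare_words (t : B) (e : R) : 0 <= e <= 1 ->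
  #|rare_words e t|%:R <= b ^+ n * expR (- (e ^+ 2 / 4) * n%:R).
Proof.
move=> /andP[e0 e1]; set S := rare_words e t.
have b1 : 1 <= b by rewrite ler1n; apply/card_gt0P; exists t.
have b0 : 0 < b by lra.
pose l := e / 2; have l0 : 0 <= l by rewrite /l; lra.
have h1 : #|S|%:R * expR (- l * ((b^-1 - e) * n%:R)) <= (b - 1 + expR (- l)) ^+ n.
  rewrite -(sum_exp_occurrences t) mulr_natl -sumr_const.
  rewrite [leRHS](bigID (mem S)) /= -[leLHS]addr0; apply: lerD; last first.
    by apply: sumr_ge0 => x _; exact: expR_ge0.
  apply: ler_sum => x; rewrite inE => xS; rewrite ler_expR; nra.
(* [1 + x <= expR x] with [x = (expR (- l) - 1) / b] and [expR (- l) <= 1 - l + l ^+ 2] *)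
have h2 : b - 1 + expR (- l) <= b * expR ((- l + l ^+ 2) / b).
  have := expRN_le l0; have := expR_ge1Dx ((- l + l ^+ 2) / b) => h h'.
  have := ler_wpM2l (ltW b0) h; rewrite mulrDr mulr1 mulrCA divff ?gt_eqF// mulr1.
  by move=> /(le_trans _); apply; lra.
have := h1; rewrite -ler_pdivlMr ?expR_gt0// => /le_trans; apply.
rewrite ler_pdivrMr ?expR_gt0// -mulrA -expRD.
have h3 : (b - 1 + expR (- l)) ^+ n <= (b * expR ((- l + l ^+ 2) / b)) ^+ n.
  apply: lerXn2r => //; rewrite nnegrE; last by rewrite mulr_ge0 ?expR_ge0// ltW.
  by have := expR_ge0 (- l); lra.
apply: (le_trans h3); rewrite exprMn ler_pM2l ?exprn_gt0// -expRM_natr ler_expR.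
rewrite mulrA -mulrDl; apply: ler_wpM2r => //.
have bi1 : b^-1 <= 1 by rewrite invf_le1.
have bi0 : 0 <= b^-1 by rewrite invr_ge0 ltW.
by rewrite /l; nra.
Qed.

Lemma card_sparse_words (e : R) : 0 <= e <= 1 ->
  #|sparse_words e|%:R <= b * (b ^+ n * expR (- (e ^+ 2 / 4) * n%:R)).
Proof.
move=> e01; have sub : (#|sparse_words e| <= \sum_(t : B) #|rare_words e t|)%N.
  rewrite (_ : sparse_words e = \bigcup_(t : B) rare_words e t)%SET; last first.
    apply/setP => x; rewrite inE; apply/existsP/finset.bigcupP => [[t xt]|[t _]].
      by exists t => //; rewrite inE.
    by rewrite inE; exists t.
  apply: (big_ind2 (fun (S : {set {ffun 'I_n -> B}}) (k : nat) => #|S| <= k)%N) => //.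
    by rewrite cards0.
  move=> S1 k1 S2 k2 h1 h2; apply: (leq_trans (leq_card_setU _ _)).
  exact: leq_add.
rewrite -(ler_nat R) in sub; apply: (le_trans sub).
rewrite natr_sum mulr_natl -sumr_const; apply: ler_sum => t _.
exact: card_rare_words.
Qed.

End chernoff.

(** * Unbalanced diagrams and unbalanced graphs *)

Lemma sorting_perm (m K : nat) (x : 'I_m -> 'I_K) :
  exists s : {perm 'I_m}, {homo (fun p => x (s p) : nat) : p q / (p <= q)%N}.
Proof.
pose r := relpre x (fun i j : 'I_K => (i <= j)%N).
have rtot : total r by move=> p q; exact: leq_total.
have rtr : transitive r by move=> p q t; exact: leq_trans.
pose l := sort r (enum 'I_m).
have sl : size l = m by rewrite size_sort size_enum_ord.
have ul : uniq l by rewrite sort_uniq enum_uniq.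
have inj : injective (fun p : 'I_m => nth p l p).
  move=> p q; rewrite (set_nth_default p) ?sl// => /eqP.
  by rewrite nth_uniq ?sl// => /eqP/val_inj.
exists (perm inj) => p q pq; rewrite !permE (set_nth_default p q) ?sl//.
have := sorted_leq_nth rtr (fun z => leqnn (x z)) p (sort_sorted rtot (enum 'I_m)).
by apply; rewrite // inE -/l sl.
Qed.

Section balanced_diagrams.
Variables (R : realType) (K n : nat) (e : R).
Local Notation diagram := {ffun 'I_n * bool -> 'I_(n.*2)}.
Implicit Types (f : diagram) (g : {ffun 'I_(n.*2) -> 'I_K}).

Definition chord_types g f : {ffun 'I_n -> 'I_K * 'I_K} :=
  [ffun i => (g (f (i, false)), g (f (i, true)))].

(** The arcs are the level sets of a monotone [g] and their lengths are free.
    This freedom is what makes the comparison with random words exact, as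
    the number of ends that fall in an arc need not be conditioned on. *)
Definition balanced f : bool :=
  [exists g : {ffun 'I_(n.*2) -> 'I_K},
    [forall p : 'I_(n.*2), forall q : 'I_(n.*2), (p <= q)%N ==> (g p <= g q)%N] &&
    (chord_types g f \notin sparse_words _ n e)].

Definition unbalanced_diagrams : {set diagram} := [set f in diagrams n | ~~ balanced f]%SET.

(** Fix a word [x] of length [2n] and sort it by a permutation [s] of the
    positions.  If [f] is unbalanced, the monotone word obtained by sorting [x] shows
    that the chord types of [s \o f] read in [x] are sparse, and [f |-> s \o f] is
    injective.  Now sum over [x] and exchange the two sums. *)
Lemma card_unbalanced :
  (#|unbalanced_diagrams| * K ^ n.*2 <=
   (n.*2)`! * #|sparse_words ('I_K * 'I_K)%type n e|)%N.
Proof.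
have -> : (K ^ n.*2 = #|{: {ffun 'I_(n.*2) -> 'I_K}}|)%N by rewrite card_ffun !card_ord.
rewrite mulnC -sum_nat_const -card_diagrams -sum_nat_const.
pose low x f := chord_types x f \in sparse_words _ n e.
apply: (@leq_trans (\sum_(x : {ffun 'I_(n.*2) -> 'I_K}) #|[set f in diagrams n | low x f]%SET|)).
  apply: leq_sum => x _; have [s sP] := sorting_perm x.
  pose c f : diagram := [ffun z => s (f z)].
  have ci : injective c.
    move=> f f' /ffunP ff'; apply/ffunP => z; have := ff' z; rewrite !ffunE.
    exact: perm_inj.
  rewrite -(card_imset _ ci); apply: subset_leq_card; apply/fintype.subsetP => _ /imsetP[f + ->].
  rewrite !inE => /andP[/injectiveP fi nb]; apply/andP; split.
    by apply/injectiveP => z z'; rewrite !ffunE => /perm_inj/fi.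
  apply: contraNT nb => nlow; apply/existsP; exists [ffun p => x (s p)]; apply/andP; split.
    by apply/forallP => p; apply/forallP => q; apply/implyP; rewrite !ffunE; exact: sP.
  move: nlow; rewrite /low (_ : chord_types x (c f) = chord_types [ffun p => x (s p)] f)//.
  by apply/ffunP => i; rewrite !ffunE.
rewrite (eq_bigr (fun x => \sum_(f in diagrams n | low x f) 1)%N); last first.
  by move=> x _; rewrite -sum1_card; apply: eq_bigl => f; rewrite inE.
rewrite (exchange_big_dep (mem (diagrams n))) /=; last by move=> x f _ /andP[].
apply: leq_sum => f fd; rewrite sum1dep_card; have fi := elimT (diagramP f) fd.
have [h fh hf] : bijective f.
  by apply: inj_card_bij => //; rewrite card_prod !card_ord card_bool muln2.
have ti : injective (fun x => chord_types x f).
  move=> x y /ffunP xy; apply/ffunP => p; rewrite -(hf p); case: (h p) => i b.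
  by have := xy i; rewrite !ffunE => -[]; case: b.
rewrite -(card_imset _ ti); apply: subset_leq_card.
by apply/fintype.subsetP => _ /imsetP[x + ->]; rewrite inE /= inE => /andP[].
Qed.

Definition relabel f (s : {perm 'I_n}) (c : {ffun 'I_n -> bool}) : diagram :=
  [ffun z => f (s z.1, z.2 (+) c z.1)].

Lemma relabel_diagram f s c : f \in diagrams n -> relabel f s c \in diagrams n.
Proof.
move=> /diagramP fi; apply/diagramP => -[i b] [j d]; rewrite !ffunE /= => /fi[].
by move=> /perm_inj ->; case: (c j); case: b; case: d.
Qed.

Lemma adj_relabel f s c i j : f \in diagrams n ->
  adj (diagram_graph (relabel f s c)) i j = adj (diagram_graph f) (s i) (s j).
Proof.
move=> fd; have rd := relabel_diagram s c fd.
have [->|ij] := eqVneq i j.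
  by rewrite !adj_height_graph /height_adj ?eqxx//; exact: diagram_heights.
have sij : s i != s j by rewrite (inj_eq perm_inj).
rewrite (adj_diagram rd ij false false) (adj_diagram fd sij (c i) (c j)).
by rewrite !ffunE /=; case: (c i); case: (c j).
Qed.

Lemma balanced_relabel f (s : {perm 'I_n}) : balanced (relabel f s [ffun=> false]) -> balanced f.
Proof.
move=> /existsP[g /andP[gm gb]]; apply/existsP; exists g; rewrite gm /=.
apply: contraNN gb; rewrite !inE => /existsP[t tP]; apply/existsP; exists t.
suff -> : occurrences (chord_types g (relabel f s [ffun=> false])) t =
  occurrences (chord_types g f) t by [].
rewrite /occurrences -(card_imset _ (@perm_inj _ s)); apply: eq_card => i.
apply/imsetP/idP => [[j + ->]|]; rewrite !inE !ffunE //=.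
move=> it; exists ((s^-1)%g i); last by rewrite permKV.
by rewrite inE !ffunE /= permKV.
Qed.

Definition circle_graphs : {set ugraph n} :=
  [set u : ugraph n | `[< circle_graph R u >]]%SET.

Definition unbalanced_graphs : {set ugraph n} :=
  [set u in circle_graphs | [forall f in diagrams n,
    (diagram_graph f == labeled u) ==> ~~ balanced f]]%SET.

Lemma ugraph_eq (u v : ugraph n) : isob (labeled u) (labeled v) -> u = v.
Proof. by move=> uv; rewrite -(reprK u) -(reprK v); apply/eqmodP. Qed.

Lemma labeled_iso (G : sgraph n) : isob (labeled (\pi_(ugraph n) G)%qT) G.
Proof. by apply: (introT (eqmodP (isob_equiv n) _ _)); rewrite reprK. Qed.

(** The relabellings of one diagram of the graph are pairwise distinct.  None is
    balanced, because undoing the permutation keeps the type counts and gives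
    a diagram of the graph with its original labelling. *)
Lemma card_unbalanced_graphs :
  (#|unbalanced_graphs| * (n`! * 2 ^ n) <= #|unbalanced_diagrams|)%N.
Proof.
have le2 : (n <= n.*2)%N by rewrite -addnn leq_addr.
have /choice[F FP] (u : ugraph n) : exists f : diagram,
    circle_graph R u -> f \in diagrams n /\ labeled u = diagram_graph f.
  have [cu|ncu] := pselect (circle_graph R u).
    by have [f fd uf] := circle_diagram cu; exists f.
  by exists [ffun z => widen_ord le2 z.1].
pose P := (ugraph n * ({perm 'I_n} * {ffun 'I_n -> bool}))%type.
pose T (p : P) : diagram := relabel (F p.1) p.2.1 p.2.2.
have -> : (#|unbalanced_graphs| * (n`! * 2 ^ n) =
    #|finset.setX unbalanced_graphs [set: {perm 'I_n} * {ffun 'I_n -> bool}]%SET|)%N.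
  rewrite cardsX cardsT card_prod card_ffun card_bool card_ord.
  by rewrite card_perm_type card_ord.
rewrite -(card_in_imset (f := T)).
  apply: subset_leq_card; apply/fintype.subsetP => _ /imsetP[[u [s c]] /setXP[+ _] ->].
  rewrite !inE => /andP[/asboolP cu /forall_inP bu]; have [fd uf] := FP u cu.
  have rd := relabel_diagram s c fd.
  have := rd; rewrite inE => -> /=; apply/negP => br.
  (* only the chords are permuted back: exchanging ends does not change the graph *)
  pose f := relabel (T (u, (s, c))) s^-1%g [ffun=> false].
  have := bu f (relabel_diagram _ _ rd); rewrite (_ : _ == _) /= => [/negP|]; last first.
    apply/eqP/sgraph_eq => i j.
    by rewrite uf (adj_relabel _ _ _ _ rd) (adj_relabel _ _ _ _ fd) !permKV.
  apply.
  apply: (@balanced_relabel _ s); rewrite /f (_ : relabel _ _ _ = T (u, (s, c)))//.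
  by apply/ffunP => -[i b]; rewrite !ffunE /= !addbF permK.
move=> [u [s c]] [u' [s' c']] /setXP[+ _] /setXP[+ _].
rewrite !inE => /andP[/asboolP cu _] /andP[/asboolP cu' _]; rewrite /T /= => TT.
have [fd uf] := FP u cu; have [fd' uf'] := FP u' cu'.
have uu' : u = u'.
  apply: ugraph_eq; apply/asboolP; exists (s' \o s^-1%g); split.
    by apply: bij_comp; exact: injF_bij perm_inj.
  move=> i j; rewrite /= uf uf' -(adj_relabel s' c')// -TT adj_relabel// !permKV//.
rewrite -{}uu' {u' cu' fd' uf'} in TT *.
have fi := elimT (diagramP (F u)) fd.
have E i b : (s i, b (+) c i) = (s' i, b (+) c' i).
  by apply: fi; have /ffunP/(_ (i, b)) := TT; rewrite !ffunE.
congr (_, (_, _)).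
  by apply/permP => i; have [] := E i false.
by apply/ffunP => i; have [] := E i false.
Qed.

(** An unlabelled graph has at most [n!] labellings. *)
Lemma card_circle_graphs : (#|circle_labelings n| <= #|circle_graphs| * n`!)%N.
Proof.
have /choice[k kP] (G : sgraph n) : exists s : {perm 'I_n},
    forall x y, adj (labeled (\pi_(ugraph n) G)%qT) x y = adj G (s x) (s y).
  have /asboolP[s [sb sE]] := labeled_iso G.
  by exists (perm (bij_inj sb)) => x y; rewrite !permE sE.
have -> : (#|circle_graphs| * n`! = #|finset.setX circle_graphs [set: {perm 'I_n}]%SET|)%N.
  by rewrite cardsX cardsT card_perm_type card_ord.
pose T (G : sgraph n) : ugraph n * {perm 'I_n} := ((\pi_(ugraph n) G)%qT, k G).
rewrite -(@card_in_imset (sgraph n) (ugraph n * {perm 'I_n})%type T).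
  apply: subset_leq_card; apply/fintype.subsetP => _ /imsetP[_ /imsetP[f fd ->] ->].
  rewrite finset.in_setX finset.in_setT andbT inE; apply/asboolP.
  exact: diagram_circle fd (labeled_iso _).
move=> G H _ _ [GH kGH]; apply: sgraph_eq => i j.
have := kP G ((k G)^-1 i)%g ((k G)^-1 j)%g; rewrite GH kP kGH !permKV.
by move->.
Qed.

End balanced_diagrams.

(** * Comparison of the exponential rates *)

Lemma nat_sqrt (n : nat) : exists q, (q ^ 2 <= n < q.+1 ^ 2)%N.
Proof.
elim: n => [|n [q /andP[qn nq]]]; first by exists 0%N.
have [h|h] := ltnP n.+1 (q.+1 ^ 2); first by exists q; rewrite h (leq_trans qn).
by exists q.+1; rewrite h /=; apply: (leq_ltn_trans nq); rewrite ltn_exp2r.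
Qed.

Lemma leq_expn_ffact (m k : nat) : ((m - k) ^ k <= m ^_ k)%N.
Proof.
have [mk|km] := ltnP m k.
  have -> : (m - k = 0)%N by apply/eqP; rewrite subn_eq0 ltnW.
  by rewrite exp0n //; exact: leq_ltn_trans mk.
rewrite -[X in (_ ^ X)%N]card_ord -prod_nat_const ffact_prod; apply: leq_prod => i _.
by rewrite leq_sub2l // ltnW.
Qed.

Lemma fact_le_expn (m k : nat) : ((m + k)`! <= (m + k) ^ k * m`!)%N.
Proof.
have mono a b j : (a <= b)%N -> (a ^ j <= b ^ j)%N.
  by move=> ab; case: j => // j; rewrite leq_exp2r.
elim: k => [|k IH]; first by rewrite addn0 expn0 mul1n.
rewrite addnS factS expnS -mulnA leq_mul //; apply: (leq_trans IH).
by rewrite leq_mul2r mono ?orbT.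
Qed.

Section rates.
Variable R : realType.

Lemma expR_ge_cube (y : R) : 0 <= y -> (y / 3) ^+ 3 <= expR y.
Proof.
move=> y0; rewrite [in leRHS](_ : y = (y / 3) * 3%:R); last by rewrite divfK.
rewrite expRM_natr; apply: lerXn2r; rewrite ?nnegrE ?expR_ge0 ?divr_ge0//.
by apply: le_trans (expR_ge1Dx _); rewrite lerDr.
Qed.

(** [A] is taken of order [L * sqrt n] with a large constant [L]: the factor lost
    to the frame is then [exp (O(sqrt n * ln n))], and the proportion [(A + 2N) / A ^ 2]
    of forbidden pairs of arcs is small. *)
Lemma frame_size (c : R) : 0 < c -> exists n0, forall n, (n0 <= n)%N -> exists A N,
  [/\ n = (A + N)%N, (n.*2)%:R ^+ A.*2 <= expR (c * n%:R) &
      A%:R ^+ 2 <= expR c * (A%:R ^+ 2 - A%:R - 2 * N%:R) :> R].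
Proof.
move=> c0; pose eta := 1 - expR (- c).
have eta0 : 0 < eta by rewrite subr_gt0 -expR0 ltr_expR oppr_lt0.
have eta1 : eta < 1 by rewrite ltrBlDr ltrDl expR_gt0.
(* [4 / eta <= L] bounds both [A] and [2 * N] by [eta * A ^ 2 / 2] *)
have [L Lbig] : exists L : nat, 4 / eta <= L%:R.
  by exists (Num.truncn (4 / eta)).+1; rewrite ltW// truncnS_gt.
have L4 : 4 <= L%:R :> R by apply: le_trans Lbig; rewrite ler_pdivlMr//; nra.
have etaL : 4 <= eta * L%:R by move: Lbig; rewrite ler_pdivrMr// mulrC.
pose g := c / (4 * L%:R).
have g0 : 0 < g by rewrite divr_gt0//; lra.
(* large enough for [8 * q ^ 2] to be at most [(g * q / 3) ^ 3] *)
have [Q Qbig] : exists Q : nat, 8 * 27 / g ^+ 3 <= Q%:R.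
  by exists (Num.truncn (8 * 27 / g ^+ 3)).+1; rewrite ltW// truncnS_gt.
exists (maxn Q (2 * L) ^ 2)%N => n n0n; have [q /andP[qn nq]] := nat_sqrt n.
have : (maxn Q (2 * L) <= q)%N by rewrite -ltnS -(ltn_exp2r _ _ (ltn0Sn 1)) (leq_ltn_trans n0n).
rewrite geq_max => /andP[Qq Lq].
have q2L : 2 * L%:R <= q%:R :> R by rewrite -natrM ler_nat.
have An : (L * q.+1 <= n)%N.
  apply: leq_trans qn; rewrite -(ler_nat R) natrM natrX -natr1; nra.
exists (L * q.+1)%N, (n - L * q.+1)%N; split; first by rewrite subnKC.
  have q0 : 0 < q%:R :> R by lra.
  have n1 : (n.*2)%:R <= expR (g * q%:R) :> R.
    apply: (@le_trans _ _ ((g * q%:R / 3) ^+ 3)); last first.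
      by apply: expR_ge_cube; rewrite mulr_ge0 ?(ltW g0).
    have : (n%:R <= (q%:R + 1) ^+ 2 :> R) by rewrite natr1 -natrX ler_nat ltnW.
    rewrite -muln2 natrM => nq2.
    apply: (@le_trans _ _ (8 * q%:R ^+ 2)); first nra.
    rewrite (_ : (g * q%:R / 3) ^+ 3 = (g ^+ 3 * q%:R / 27) * q%:R ^+ 2); last by field.
    apply: ler_wpM2r; first exact: sqr_ge0.
    have : 8 * 27 / g ^+ 3 <= q%:R by apply: (le_trans Qbig); rewrite ler_nat.
    by rewrite ler_pdivrMr ?exprn_gt0// => h; lra.
  apply: (@le_trans _ _ (expR (g * q%:R) ^+ (L * q.+1).*2)).
    by apply: lerXn2r; rewrite ?nnegrE ?expR_ge0.
  rewrite -expRM_natr ler_expR.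
  have : (q%:R ^+ 2 <= n%:R :> R) by rewrite -natrX ler_nat.
  rewrite -muln2 !natrM -natr1 => qn'.
  have L0 : L%:R != 0 :> R by apply/eqP => h; lra.
  apply: (@le_trans _ _ (c * q%:R ^+ 2)); last by rewrite ler_pM2l.
  rewrite (_ : g * q%:R * (L%:R * (q%:R + 1) * 2%:R) = c * (q%:R * (q%:R + 1) / 2)); last first.
    by rewrite /g; field.
  rewrite ler_pM2l//; nra.
rewrite -ler_pdivrMl ?expR_gt0// -expRN.
set x := (L * q.+1)%:R : R.
have -> : expR (- c) = 1 - eta by rewrite /eta; ring.
suff : x + 2 * (n - L * q.+1)%:R <= eta * x ^+ 2 by lra.
have nqR : n%:R <= (q%:R + 1) ^+ 2 :> R by rewrite natr1 -natrX ler_nat ltnW.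
have xE : x = L%:R * (q%:R + 1) by rewrite /x natrM -natr1.
rewrite natrB// -/x; have q0 : 0 <= q%:R :> R by [].
have h1 : 4 * x <= eta * x ^+ 2.
  rewrite expr2 mulrA ler_wpM2r//.
  by rewrite xE mulrA; nra.
have h2 : 4 * (q%:R + 1) ^+ 2 <= eta * x ^+ 2.
  rewrite xE exprMn [leRHS]mulrA; apply: ler_wpM2r; first exact: sqr_ge0.
  nra.
by have : 0 <= x by []; nra.
Qed.

(** The [A] frame chords account for a factor at most [(2n) ^ (2A)], and the pairs of
    arcs already taken for a factor at most [(1 - (A + 2N) / A ^ 2) ^ (- N)]. *)
Lemma card_circle_labelings_ge (c : R) : 0 < c -> exists n0, forall n, (n0 <= n)%N ->
  (n.*2)`!%:R <= expR (c * n%:R) * 2 ^+ n * #|circle_labelings n|%:R :> R.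
Proof.
move=> c0; have c20 : 0 < c / 2 by lra.
have [n0 n0P] := frame_size c20; exists n0 => n n0n.
have [A [N [nE h1 h2]]] := n0P n n0n; have := card_circle_labelings A N; rewrite -nE => lab.
have Npos : 0 < expR (c * n%:R) * 2 ^+ n :> R by rewrite mulr_gt0 ?exprn_gt0 ?expR_gt0.
(* without arcs there is no chord either, and [n = 0] *)
have [A0|A0] := posnP A.
  have N0 : N = 0%N.
    move: h2; rewrite A0 (_ : _ - _ - _ = - (2 * N%:R)); last by ring.
    rewrite expr0n /= pmulr_rge0 ?expR_gt0// oppr_ge0.
    by rewrite pmulr_rle0// lern0 => /eqP.
  by move: lab; rewrite nE A0 N0 /= ffactn0 !mul1n muln1 mulr0 expR0 expr0 !mul1r ler_nat.
have Apos : (0 < A ^ N.*2)%N by rewrite expn_gt0 A0.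
rewrite -(ler_pM2r (_ : 0 < (A ^ N.*2)%:R)) ?ltr0n//.
rewrite -[leRHS]mulrA.
apply: (@le_trans _ _ (expR (c * n%:R) * 2 ^+ n * ('C(A, 2) ^_ N * (N.*2)`!)%:R)); last first.
  by rewrite (ler_pM2l Npos) -natrM ler_nat.
have f1 : ((n.*2)`! <= n.*2 ^ A.*2 * (N.*2)`!)%N.
  by rewrite nE doubleD addnC; exact: fact_le_expn.
apply: (@le_trans _ _ ((n.*2 ^ A.*2 * (N.*2)`!)%:R * (A ^ N.*2)%:R)).
  by rewrite ler_wpM2r ?ler_nat.
rewrite !natrM !natrX mulrAC mulrA; apply: ler_wpM2r => //.
rewrite -[N.*2]mul2n exprM.
apply: (@le_trans _ _ (expR (c / 2 * n%:R) * (expR (c / 2) * (A%:R ^+ 2 - A%:R - 2 * N%:R)) ^+ N)).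
  apply: ler_pM; rewrite ?exprn_ge0 ?sqr_ge0//.
  by apply: lerXn2r => //; rewrite nnegrE ?sqr_ge0// (le_trans _ h2)// sqr_ge0.
have h3 : 0 <= A%:R ^+ 2 - A%:R - 2 * N%:R :> R.
  by rewrite -(pmulr_rge0 _ (expR_gt0 (c / 2))) (le_trans _ h2)// sqr_ge0.
have h4 : A%:R ^+ 2 - A%:R - 2 * N%:R = 2 * ('C(A, 2) - N)%:R :> R.
  have e2 : ('C(A, 2) * 2 = A * A.-1)%N by have := bin_ffact A 2; rewrite !ffactnS ffactn0 muln1.
  have e3 : 2 * ('C(A, 2))%:R = A%:R ^+ 2 - A%:R :> R.
    by rewrite mulrC -natrM e2 natrM -subn1 natrB//; ring.
  rewrite natrB; last by rewrite -(ler_nat R); lra.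
  by rewrite -e3; ring.
rewrite h4 !exprMn mulrA.
have h5 : expR (c / 2 * n%:R) * expR (c / 2) ^+ N <= expR (c * n%:R).
  rewrite -expRM_natr -expRD ler_expR -mulrDr.
  have : N%:R <= n%:R :> R by rewrite ler_nat nE leq_addl.
  nra.
rewrite !mulrA; apply: ler_pM.
- by rewrite !mulr_ge0 ?exprn_ge0 ?expR_ge0.
- by rewrite exprn_ge0.
- apply: ler_pM; rewrite ?mulr_ge0 ?exprn_ge0 ?expR_ge0//.
  by rewrite ler_weXn2l ?ler1n// nE leq_addl.
- by rewrite -natrX ler_nat; exact: leq_expn_ffact.
Qed.

(** Relabelling multiplies the number of unbalanced graphs by [n! 2 ^ n], dividing
    by [n!] passes from labelled to unlabelled graphs, and half of the exponential
    gain of the Chernoff bound absorbs the subexponential loss of the lower bound. *)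
Lemma unbalanced_graphs_rare (K : nat) (e : R) : (0 < K)%N -> 0 < e <= 1 ->
  exists n0, forall n, (n0 <= n)%N ->
  #|unbalanced_graphs K n e|%:R <=
    (K * K)%:R * expR (- (e ^+ 2 / 8) * n%:R) * #|circle_graphs R n|%:R :> R.
Proof.
move=> K0 /andP[e0 e1]; have c0 : 0 < e ^+ 2 / 8 by rewrite divr_gt0 ?exprn_gt0.
have [n0 n0P] := card_circle_labelings_ge c0; exists n0 => n n0n.
have lab := n0P n n0n.
have u1 := card_unbalanced_graphs K n e.
have u2 := card_unbalanced K n e.
have := @card_sparse_words R ('I_K * 'I_K)%type n e; rewrite (ltW e0) e1 => /(_ isT).
have := card_circle_graphs R n.
move: (#|unbalanced_graphs K n e|) (#|unbalanced_diagrams K n e|) (#|circle_graphs R n|)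
  (#|sparse_words _ n e|) (#|circle_labelings n|) lab u1 u2 => X U C S L.
rewrite card_prod !card_ord => lab u1 u2 CL Sle.
have KK : 0 < (K * K)%:R :> R by rewrite ltr0n muln_gt0 K0.
have n2 : 0 < (n`! * 2 ^ n)%:R :> R by rewrite ltr0n muln_gt0 fact_gt0 expn_gt0.
set k := (K * K)%:R : R in KK Sle *.
have kn : (K ^ n.*2)%:R = k ^+ n :> R by rewrite /k -natrX -mul2n expnM mulnn.
have U1 : U%:R <= (n.*2)`!%:R * (k * expR (- (e ^+ 2 / 4) * n%:R)) :> R.
  rewrite -(ler_pM2r (exprn_gt0 n KK)) -kn -natrM.
  apply: (@le_trans _ _ ((n.*2)`! * S)%:R); first by rewrite ler_nat.
  rewrite natrM -mulrA ler_wpM2l// kn (le_trans Sle)//.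
  by rewrite mulrCA [leRHS]mulrC.
rewrite -(ler_pM2r n2) -natrM.
apply: (@le_trans _ _ U%:R); first by rewrite ler_nat.
apply: (le_trans U1).
apply: (@le_trans _ _ (expR (e ^+ 2 / 8 * n%:R) * 2 ^+ n * L%:R *
    (k * expR (- (e ^+ 2 / 4) * n%:R)))).
  by apply: ler_wpM2r => //; rewrite mulr_ge0 ?expR_ge0 ?ltW.
have -> : - (e ^+ 2 / 8) * n%:R = e ^+ 2 / 8 * n%:R + (- (e ^+ 2 / 4) * n%:R) by field.
rewrite expRD natrM natrX.
rewrite [leLHS](_ : _ = k * (expR (e ^+ 2 / 8 * n%:R) * expR (- (e ^+ 2 / 4) * n%:R)) * 2 ^+ n * L%:R);
  last by ring.
rewrite [leRHS](_ : _ = k * (expR (e ^+ 2 / 8 * n%:R) * expR (- (e ^+ 2 / 4) * n%:R)) * 2 ^+ n *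
  (C%:R * n`!%:R)); last by ring.
apply: ler_wpM2l; last by rewrite -natrM ler_nat.
by rewrite !mulr_ge0 ?expR_ge0 ?exprn_ge0 ?ltW.
Qed.

End rates.

(** * Matching two labellings by a permutation *)

(** For a permutation with the most agreements, every value [t] is either always
    hit where it is expected or never put where it is not. *)
Lemma agreeing_perm (n : nat) (T : finType) (a b : 'I_n -> T) :
  exists s : {perm 'I_n}, (#|[set c | b (s c) != a c]%SET| <=
    \sum_(t : T) (#|[set c | b c == t]%SET| - #|[set c | a c == t]%SET|))%N.
Proof.
pose agree (s : {perm 'I_n}) := [set c | b (s c) == a c]%SET.
have := @arg_maxnP _ (1%g : {perm 'I_n}) xpredT (fun s => #|agree s|) isT.
case: arg_maxnP => // s _ smax _; exists s.
pose M t := [set c | (b (s c) == t) && (a c != t)]%SET.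
have -> : (#|[set c | b (s c) != a c]%SET| = \sum_(t : T) #|M t|)%N.
  rewrite -sum1_card (partition_big (fun c => b (s c)) xpredT) //=.
  apply: eq_bigr => t _; rewrite -sum1_card; apply: eq_bigl => c; rewrite !inE.
  by rewrite andbC; case: eqP => // ->; rewrite eq_sym.
apply: leq_sum => t _; have [->|[c]] := set_0Vmem (M t); first by rewrite cards0.
rewrite inE => /andP[bc ac].
(* otherwise exchanging the images of [x] and [c] would increase the agreement *)
have all_t x : a x == t -> b (s x) == t.
  move=> ax; apply: contraTT isT => bx.
  pose s' := (tperm x c * s)%g.
  have /= := smax s' isT; rewrite leqNgt => /negP; case.
  apply: proper_card; apply/properP; split.
    apply/fintype.subsetP => y; rewrite !inE permM.
    have [->|yx] := eqVneq y x; first by rewrite (eqP ax) (negPf bx).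
    have [->|yc] := eqVneq y c; first by rewrite (eqP bc) eq_sym (negPf ac).
    by rewrite tpermD // eq_sym.
  exists x; rewrite inE; last by rewrite (eqP ax).
  by rewrite permM tpermL (eqP bc) eq_sym.
have -> : (#|[set c | b c == t]%SET| = #|[set c | b (s c) == t]%SET|)%N.
  rewrite -[RHS](card_imset _ (@perm_inj _ s)); apply: eq_card => x.
  apply/idP/imsetP => [bx|[y + ->]]; last by rewrite !inE.
  exists ((s^-1)%g x); last by rewrite permKV.
  by move: bx; rewrite !inE permKV.
rewrite leq_subRL; last first.
  by apply: subset_leq_card; apply/fintype.subsetP => x; rewrite !inE => /all_t.
rewrite -[leqRHS](cardsID [set c | a c == t]%SET); apply: leq_add.
  by apply: subset_leq_card; apply/fintype.subsetP => x; rewrite !inE => ax; rewrite ax all_t.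
by apply: subset_leq_card; apply/fintype.subsetP => x; rewrite !inE andbC.
Qed.

Section value_counts.
Variable R : realType.
Variables (n : nat) (T : finType).
Implicit Types (a : 'I_n -> T) (e : R).
Local Notation count a t := (#|[set c | a c == t]%SET|).
Local Notation b := (#|T|%:R : R).

Lemma sum_value_counts a : (\sum_(t : T) count a t = n)%N.
Proof.
rewrite -[RHS]card_ord -sum1_card (partition_big a xpredT) //=.
by apply: eq_bigr => t _; rewrite -sum1_card; apply: eq_bigl => c; rewrite !inE.
Qed.

(** The counts add up to [n], hence lower bounds on all of them give upper bounds. *)
Lemma value_counts_le a e : (forall t, (b^-1 - e) * n%:R <= (count a t)%:R) ->
  forall t, (count a t)%:R <= (b^-1 + b * e) * n%:R - e * n%:R.
Proof.
move=> lo t; have b0 : 0 < b by rewrite ltr0n; apply/card_gt0P; exists t.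
have : \sum_(t' | t' != t) (b^-1 - e) * n%:R <= \sum_(t' | t' != t) (count a t')%:R :> R.
  by apply: ler_sum.
have nE : n%:R = (count a t)%:R + \sum_(t' | t' != t) (count a t')%:R :> R.
  by rewrite -[in LHS](sum_value_counts a) natr_sum (bigD1 t).
have bE : b = 1 + \sum_(t' | t' != t) 1 :> R.
  by rewrite -sumr_const (bigD1 t).
have -> : \sum_(t' | t' != t) (b^-1 - e) * n%:R = (b - 1) * ((b^-1 - e) * n%:R) :> R.
  have -> : b - 1 = \sum_(t' | t' != t) 1 by rewrite {1}bE; ring.
  by rewrite mulr_suml; apply: eq_bigr => t' _; rewrite mul1r.
move=> h; have : n%:R >= (count a t)%:R + (b - 1) * ((b^-1 - e) * n%:R) by lra.
have -> : (b - 1) * ((b^-1 - e) * n%:R) = n%:R - (b^-1 + b * e) * n%:R + e * n%:R.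
  by field; rewrite gt_eqF.
lra.
Qed.

Lemma close_counts_perm a a' e : 0 <= e ->
  (forall t, (b^-1 - e) * n%:R <= (count a t)%:R) ->
  (forall t, (b^-1 - e) * n%:R <= (count a' t)%:R) ->
  exists s : {perm 'I_n}, #|[set c | a' (s c) != a c]%SET|%:R <= b ^+ 2 * e * n%:R.
Proof.
move=> e0 la la'; have [s sP] := agreeing_perm a a'; exists s.
rewrite -(ler_nat R) in sP; apply: (le_trans sP); rewrite natr_sum.
rewrite (_ : b ^+ 2 * e * n%:R = b * (b * e * n%:R)); last by ring.
rewrite mulr_natl -sumr_const; apply: ler_sum => t _.
have [h|h] := leqP (count a' t) (count a t).
  rewrite (eqP (_ : _ - _ == 0)%N) ?subn_eq0//.
  by rewrite !mulr_ge0.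
rewrite natrB ?(ltnW h)//; have := la t; have := value_counts_le la' t.
by lra.
Qed.

End value_counts.

(** * Interval exchange maps *)

Lemma measure_bigsetU_le d (X : measurableType d) (R : realType)
    (mu : {measure set X -> \bar R}) (I : Type) (r : seq I) (P : pred I) (F : I -> set X) :
  (forall i, measurable (F i)) ->
  (mu (\big[setU/set0]_(i <- r | P i) F i) <= \sum_(i <- r | P i) mu (F i))%E.
Proof.
move=> mF; elim: r => [|i r IH]; first by rewrite !big_nil measure0.
rewrite !big_cons; case: ifP => // _.
apply: le_trans (measureU2 _ _ _) _ => //; first exact: bigsetU_measurable.
exact: leeD2l.
Qed.

Lemma in_bigsetU (X : Type) (I : finType) (P : pred I) (F : I -> set X) i x :
  P i -> F i x -> (\big[setU/set0]_(i | P i) F i) x.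
Proof. by move=> Pi Fx; rewrite (bigD1 i) //=; left. Qed.

Section interval_permutations.
Variable R : realType.
Local Notation I01 := (`[0, 1]%classic : set R).
Local Notation leb := (@lebesgue_measure R).

Lemma lebesgue_translation (c : R) (A : set R) : measurable A ->
  leb ((fun x => x + c) @^-1` A) = leb A.
Proof.
move=> mA; rewrite -[LHS]/(pushforward leb
  ((fun x => x + c) : measurableTypeR R -> measurableTypeR R) A).
apply/esym/lebesgue_measure_unique => //=.
  by apply: (measurable_funD (@measurable_id _ _ setT)); exact: measurable_cst.
move=> mc _ [[a b]] _ <-; rewrite /pushforward.
rewrite (_ : _ @^-1` _ = `]a - c, b - c]%classic); last first.
  by apply/seteqP; split => x; rewrite /= !in_itv/= ltrBlDr lerBrDr.
rewrite !lebesgue_measure_itv/= !lte_fin ltrD2r.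
by rewrite -!EFinB; congr (if _ then _%:E else _); ring.
Qed.

End interval_permutations.

Section interval_exchange.
Variable R : realType.
Local Notation I01 := (`[0, 1]%classic : set R).
Local Notation leb := (@lebesgue_measure R).

(** Open on the left: these are the sets on which [ceil (n x)] is constant. *)
Definition cell (n i : nat) : set R := `](i%:R / n%:R), (i.+1%:R / n%:R)]%classic.

Lemma measurable_cell n i : measurable (cell n i).
Proof. exact: measurable_itv. Qed.

Lemma cellP n i x : (0 < n)%N -> cell n i x <-> i%:R < n%:R * x <= i.+1%:R.
Proof.
move=> n0; have n0R : 0 < n%:R :> R by rewrite ltr0n.
by rewrite /cell /= in_itv/= ltr_pdivrMr// ler_pdivlMr// mulrC.
Qed.

Lemma cell_ceil n i x : (0 < n)%N -> cell n i x <-> (Num.ceil (n%:R * x) == i.+1 :> int).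
Proof.
move=> n0; rewrite cellP// ceil_eq.
by have -> : i.+1%:Z - 1 = i%:Z by lia.
Qed.

Lemma lebesgue_cell n i : (0 < n)%N -> leb (cell n i) = (n%:R^-1)%:E.
Proof.
move=> n0; have n0R : 0 < n%:R :> R by rewrite ltr0n.
rewrite lebesgue_measure_itv/= lte_fin ltr_pM2r ?invr_gt0// ltr_nat ltnSn.
by rewrite -EFinB -natr1; congr _%:E; field; rewrite gt_eqF.
Qed.

Lemma cell_sub01 n (i : 'I_n) : cell n i `<=` I01.
Proof.
move=> x; have n0 : (0 < n)%N by exact: leq_ltn_trans (ltn_ord i).
have n0R : 0 < n%:R :> R by rewrite ltr0n.
rewrite cellP// /= in_itv/= => /andP[ix xi]; apply/andP; split.
  by rewrite -(pmulr_rge0 _ n0R) ltW// (le_lt_trans _ ix).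
by rewrite -(ler_pM2l n0R) mulr1 (le_trans xi)// ler_nat.
Qed.

Lemma cell_uniq n (i j : nat) x : (0 < n)%N -> cell n i x -> cell n j x -> i = j.
Proof.
move=> n0; rewrite !cell_ceil// => /eqP -> /eqP; lia.
Qed.

Lemma cell_ex n x : (0 < n)%N -> 0 < x <= 1 -> exists i : 'I_n, cell n i x.
Proof.
move=> n0 /andP[x0 x1]; have n0R : 0 < n%:R :> R by rewrite ltr0n.
have c0 : 0 < Num.ceil (n%:R * x) by rewrite ltNge ceil_le0 -ltNge mulr_gt0.
have c1 : Num.ceil (n%:R * x) <= n by rewrite ceil_le_int ger_pMr.
case E : (Num.ceil (n%:R * x)) c0 c1 => [[//|k]|//] _ kn.
by exists (Ordinal (kn : (k < n)%N)); apply/(cell_ceil _ _ n0); rewrite /= E.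
Qed.

Lemma lebesgue_cells n (B : set R) : (0 < n)%N -> measurable B -> B `<=` I01 ->
  leb B = (\sum_(i < n) leb (cell n i `&` B))%E.
Proof.
move=> n0 mB B01.
have mF i : measurable (cell n i `&` B) by apply: measurableI => //; exact: measurable_cell.
have BE : B = (B `&` [set 0]) `|` \big[setU/set0]_(i < n) (cell n i `&` B).
  apply/seteqP; split => [x Bx|x [[]//|]].
    have := B01 _ Bx; rewrite /= in_itv/= => /andP[]; rewrite le_eqVlt => /predU1P[x0 _|x0 x1].
      by left; split.
    have [|i ci] := @cell_ex n x n0; first by rewrite x0.
    by right; apply: (in_bigsetU (i := i)).
  by elim/big_ind: _ => // [A1 A2 h1 h2 [/h1|/h2]//|i _ []].
have m0 : measurable (B `&` [set 0]) by apply: measurableI => //; exact: measurable_set1.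
rewrite {1}BE measureU//; last 2 first.
- by apply: bigsetU_measurable => i _; exact: mF.
- apply/seteqP; split => // x [[_ ->]].
  elim/big_ind: _ => // [A1 A2 h1 h2 [/h1|/h2]//|i _ []].
  by rewrite cellP// mulr0 ltNge ler0n.
rewrite [X in (X + _)%E](_ : _ = 0%E) ?add0e; last first.
  apply/eqP; rewrite eq_le measure_ge0 andbT -(lebesgue_measure_set1 (0 : R)).
  by apply: le_measure; rewrite ?inE//; exact: measurable_set1.
rewrite measure_bigsetU_ord//; first by move=> i; exact: mF.
apply/trivIsetP => i j _ _ ij; apply/seteqP; split => // x [[ci _] [cj _]].
by case/eqP: ij; apply: val_inj; exact: cell_uniq ci cj.
Qed.

(** Translates the [i]-th cell onto the [s i]-th one.  The point [0] belongs to no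
    cell and is fixed, so that the map is a bijection of the closed unit interval. *)
Definition exchange n (s : {perm 'I_n}) (x : R) : R :=
  x + \sum_(i < n) \1_(cell n i) x * (((s i)%:R - i%:R) / n%:R).

Lemma exchange_cell n (s : {perm 'I_n}) (i : 'I_n) x : cell n i x ->
  exchange s x = x + ((s i)%:R - i%:R) / n%:R.
Proof.
move=> ci; have n0 : (0 < n)%N by exact: leq_ltn_trans (ltn_ord i).
rewrite /exchange (bigD1 i)//= big1 => [|j ji].
  by rewrite addr0 indicE mem_set// mul1r.
rewrite indicE memNset ?mul0r// => cj.
by case/eqP: ji; apply: val_inj; exact: cell_uniq cj ci.
Qed.

Lemma exchange0 n (s : {perm 'I_n}) : exchange s 0 = 0.
Proof.
rewrite /exchange big1 ?addr0// => i _; rewrite indicE memNset ?mul0r// => ci.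
have n0 : (0 < n)%N by exact: leq_ltn_trans (ltn_ord i).
by move: ci; rewrite cellP// mulr0 ltNge ler0n.
Qed.

Lemma exchange_in_cell n (s : {perm 'I_n}) (i : 'I_n) x : cell n i x ->
  cell n (s i) (exchange s x).
Proof.
move=> ci; rewrite (exchange_cell _ ci).
have n0 : (0 < n)%N by exact: leq_ltn_trans (ltn_ord i).
have n0R : n%:R != 0 :> R by rewrite pnatr_eq0 -lt0n.
move: ci; rewrite !cellP// mulrDr mulrCA divff// mulr1 -!natr1; lra.
Qed.

Lemma itv01_cases n x : (0 < n)%N -> I01 x -> x = 0 \/ exists i : 'I_n, cell n i x.
Proof.
move=> n0; rewrite /= in_itv/= => /andP[]; rewrite le_eqVlt => /predU1P[<- _|x0 x1]; first by left.
by right; apply: cell_ex => //; rewrite x0.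
Qed.

Lemma exchange01 n (s : {perm 'I_n}) : (0 < n)%N -> exchange s @` I01 `<=` I01.
Proof.
move=> n0 _ [x /(itv01_cases n0)[->|[i ci]] <-].
  by rewrite exchange0 /= in_itv/= lexx ler01.
exact: cell_sub01 (exchange_in_cell _ ci).
Qed.

Lemma exchangeK n (s : {perm 'I_n}) x : (0 < n)%N -> I01 x ->
  exchange s^-1 (exchange s x) = x.
Proof.
move=> n0 /(itv01_cases n0)[->|[i ci]]; first by rewrite !exchange0.
rewrite (exchange_cell _ (exchange_in_cell s ci)) (exchange_cell s ci) permK.
by ring.
Qed.

Lemma measurable_exchange n (s : {perm 'I_n}) : measurable_fun setT (exchange s).
Proof.
apply: measurable_funD => //; apply: measurable_sum => i.
by apply: measurable_funM => //; apply: measurable_indic; exact: measurable_cell.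
Qed.

Lemma exchange_preserving n (s : {perm 'I_n}) : (0 < n)%N ->
  measure_preserving01 (exchange s).
Proof.
move=> n0; split; [exact: measurable_funTS (measurable_exchange s)|exact: exchange01|].
move=> A mA A01.
have mpA : measurable (exchange s @^-1` A).
  by rewrite -[X in measurable X]setTI; exact: measurable_exchange.
rewrite (lebesgue_cells n0)//; last exact: measurableI.
rewrite (lebesgue_cells n0 mA A01) [RHS](reindex_inj (@perm_inj _ s)) /=.
apply: eq_bigr => i _.
have mcA : measurable (cell n (s i) `&` A) by apply: measurableI => //; exact: measurable_cell.
rewrite -(lebesgue_translation (((s i)%:R - i%:R) / n%:R) mcA); congr (leb _).
have n0R : n%:R != 0 :> R by rewrite pnatr_eq0 -lt0n.
apply/seteqP; split => x /=.
  move=> [ci [_ Ax]]; rewrite -(exchange_cell s ci); split => //.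
  exact: exchange_in_cell.
move=> [csi Ax]; have ci : cell n i x.
  by move: csi; rewrite !cellP// mulrDr mulrCA divff// mulr1 -!natr1; lra.
split => //; split; first exact: cell_sub01 ci.
by rewrite (exchange_cell s ci).
Qed.

Lemma exchange_invertible n (s : {perm 'I_n}) : (0 < n)%N -> invertible_mp01 (exchange s).
Proof.
move=> n0; split; first exact: exchange_preserving.
exists (exchange s^-1%g); split; first exact: exchange_preserving.
  by move=> x; exact: exchangeK.
by move=> x x01; rewrite -{1}(invgK s) exchangeK.
Qed.

End interval_exchange.

(** * Bounds on the cut distance *)

Section cut_distance_bound.
Variable R : realType.
Local Notation I01 := (`[0, 1]%classic : set R).
Local Notation leb := (@lebesgue_measure R).

Lemma compact_separation (K L : set R) : compact K -> compact L -> K `&` L = set0 ->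
  \forall n \near \oo, forall x y, K x -> L y -> n%:R^-1 <= `|x - y|.
Proof.
move=> cK cL KL; have clL : closed L by apply: compact_closed.
have := (iffLR (compact_near_coveringP K)) cK nat \oo
  (fun n x => forall y, L y -> n%:R^-1 <= `|x - y|) _.
move=> h; suff : \forall n \near \oo, K `<=` (fun x => forall y, L y -> n%:R^-1 <= `|x - y|).
  by apply: filterS => n hn x y Kx Ly; exact: hn.
apply: h => x Kx.
have nLx : ~ L x by move=> Lx; have : (K `&` L) x by []; rewrite KL.
have : nbhs x (~` L) by apply: open_nbhs_nbhs; split => //; exact: closed_openC.
move=> /nbhs_ballP[e /= e0 be].
have e20 : 0 < e / 2 by rewrite divr_gt0.
exists (ball x (e / 2), [set n | n%:R^-1 < e / 2]); first split => /=.
- by apply/nbhs_ballP; exists (e / 2).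
- near=> n; rewrite /= -[e / 2]invrK ltf_pV2 ?posrE ?invr_gt0//.
    by near: n; exact: nbhs_infty_gtr.
  by rewrite ltr0n; near: n; exact: nbhs_infty_gt.
move=> [x' n] [/= xx' ne] y Ly; rewrite leNgt; apply/negP => x'y.
apply: (be y) => //; rewrite /ball/= -(subrK x' x) -addrA.
apply: (le_lt_trans (ler_normD _ _)); rewrite [e]splitr.
by apply: ltrD => //; exact: lt_trans x'y ne.
Unshelve. all: by end_near. Qed.

Lemma cut_dist_ge0 (u w : graphon R) : (0 <= cut_dist u w)%E.
Proof.
apply: le_ereal_inf_tmp => _ [phi _ <-]; apply: ereal_sup_ubound.
exists (set0, set0) => /=; first by split; split => //; exact: sub0set.
by rewrite setX0 integral_set0 abse0.
Qed.

(** The two functions differ by at most [1], and only on [E]. *)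
Lemma cut_dist_le (u w : graphon R) (phi : R -> R) (E : set (R * R)) (r : \bar R) :
  invertible_mp01 phi -> measurable_fun setT phi -> measurable E ->
  (forall x y, I01 x -> I01 y -> ~ E (x, y) -> u (x, y) = w (phi x, phi y)) ->
  ((leb \x leb) E <= r)%E -> (cut_dist u w <= r)%E.
Proof.
move=> iphi mphi mE uw Er; apply: (@le_trans _ _ (ereal_sup
    [set `|\int[leb \x leb]_(z in ST.1 `*` ST.2) (u z - w (phi z.1, phi z.2))%:E|%E
    | ST in [set ST : set R * set R |
        (measurable ST.1 /\ ST.1 `<=` I01) /\ (measurable ST.2 /\ ST.2 `<=` I01)]])).
  by apply: ereal_inf_lbound; exists phi.
apply: ge_ereal_sup => _ [[S T] /= [[mS S01] [mT T01]] <-].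
have mST : measurable (S `*` T) by exact: measurableX.
have ST01 : S `*` T `<=` I01 `*` I01 by move=> [x y] [/= /S01 ? /T01 ?].
have [[_ phi01 _] _] := iphi.
have pI x : I01 x -> I01 (phi x) by move=> hx; apply: phi01; exists x.
have mphi2 : measurable_fun setT (fun z : R * R => (phi z.1, phi z.2)).
  by apply: measurable_fun_pair; apply: measurableT_comp.
have mf : measurable_fun (I01 `*` I01) (fun z : R * R => u z - w (phi z.1, phi z.2)).
  apply: measurable_funB; first exact: graphon_measurable.
  apply: (@measurable_comp _ _ _ _ _ _ (I01 `*` I01) w) => //.
  - exact: measurable_unit_square.
  - by move=> _ [z [z1 z2] <-]; split; exact: pI.
  - exact: graphon_measurable.
  - exact: measurable_funTS mphi2.
have mfST : measurable_fun (S `*` T) (fun z : R * R => (u z - w (phi z.1, phi z.2))%:E).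
  by apply/measurable_EFinP; apply: measurable_funS mf => //; exact: measurable_unit_square.
apply: le_trans Er.
have /le_trans := @le_abse_integral _ _ R (leb \x leb)%E _ _ mST mfST; apply.
apply: (@le_trans _ _ (\int[leb \x leb]_(z in S `*` T) (\1_E z)%:E)%E).
  apply: ge0_le_integral => //.
  - exact: measurableT_comp.
  - by apply/measurable_EFinP; apply: measurable_indic.
  move=> [x y] [/= Sx Ty]; rewrite lee_fin indicE.
  have [_|/negP nE] := boolP ((x, y) \in E).
    have /andP[u0 u1] := graphon_itv u (S01 _ Sx) (T01 _ Ty).
    have /andP[w0 w1] := graphon_itv w (pI _ (S01 _ Sx)) (pI _ (T01 _ Ty)).
    by rewrite ler_norml /=; apply/andP; split; lra.
  rewrite uw ?subrr ?normr0//; [exact: S01|exact: T01|].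
  by move=> Exy; apply: nE; exact: mem_set.
rewrite integral_indic//; apply: le_measure; rewrite ?inE//.
exact: measurableI.
Qed.

End cut_distance_bound.

(** * Blocks of the unit square *)

(** Each of the six possible coincidences leaves three free indices. *)
Lemma card_conflicting (K : nat) :
  (#|[pred q : ('I_K * 'I_K) * ('I_K * 'I_K) |
      ~~ uniq [:: q.1.1; q.1.2; q.2.1; q.2.2]]| <= 6 * K ^ 3)%N.
Proof.
pose Q := (('I_K * 'I_K) * ('I_K * 'I_K))%type.
have inj_le (P : pred Q) (F : Q -> 'I_K * 'I_K * 'I_K) : {in P &, injective F} ->
    (#|P| <= K ^ 3)%N.
  move=> Fi; rewrite -(card_in_imset Fi); apply: leq_trans (max_card _) _.
  by rewrite !card_prod !card_ord !expnS expn0 muln1 mulnA.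
pose P1 := [pred q : Q | q.1.1 == q.1.2].
pose P2 := [pred q : Q | q.1.1 == q.2.1].
pose P3 := [pred q : Q | q.1.1 == q.2.2].
pose P4 := [pred q : Q | q.1.2 == q.2.1].
pose P5 := [pred q : Q | q.1.2 == q.2.2].
pose P6 := [pred q : Q | q.2.1 == q.2.2].
have h1 : (#|P1| <= K ^ 3)%N.
  apply: (inj_le _ (fun q => (q.1.1, q.2.1, q.2.2))) => -[[x y] [z w]] [[x' y'] [z' w']].
  by rewrite !inE /= => /eqP -> /eqP -> [-> -> ->].
have h2 : (#|P2| <= K ^ 3)%N.
  apply: (inj_le _ (fun q => (q.1.1, q.1.2, q.2.2))) => -[[x y] [z w]] [[x' y'] [z' w']].
  by rewrite !inE /= => /eqP -> /eqP -> [-> -> ->].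
have h3 : (#|P3| <= K ^ 3)%N.
  apply: (inj_le _ (fun q => (q.1.1, q.1.2, q.2.1))) => -[[x y] [z w]] [[x' y'] [z' w']].
  by rewrite !inE /= => /eqP -> /eqP -> [-> -> ->].
have h4 : (#|P4| <= K ^ 3)%N.
  apply: (inj_le _ (fun q => (q.1.1, q.1.2, q.2.2))) => -[[x y] [z w]] [[x' y'] [z' w']].
  by rewrite !inE /= => /eqP -> /eqP -> [-> -> ->].
have h5 : (#|P5| <= K ^ 3)%N.
  apply: (inj_le _ (fun q => (q.1.1, q.1.2, q.2.1))) => -[[x y] [z w]] [[x' y'] [z' w']].
  by rewrite !inE /= => /eqP -> /eqP -> [-> -> ->].
have h6 : (#|P6| <= K ^ 3)%N.
  apply: (inj_le _ (fun q => (q.1.1, q.1.2, q.2.1))) => -[[x y] [z w]] [[x' y'] [z' w']].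
  by rewrite !inE /= => /eqP -> /eqP -> [-> -> ->].
apply: (@leq_trans (#|P1| + #|P2| + #|P3| + #|P4| + #|P5| + #|P6|)); last by lia.
have cE (P : pred Q) : #|P| = (\sum_q P q)%N.
  by rewrite -sum1_card big_mkcond; apply: eq_bigr => q _; rewrite unfold_in; case: (P q).
rewrite !cE -!big_split /=; apply: leq_sum => q _.
rewrite !inE; case: (q.1.1 == q.1.2); case: (q.1.1 == q.2.1); case: (q.1.1 == q.2.2) => //=.
by case: (q.1.2 == q.2.1); case: (q.1.2 == q.2.2) => //=; case: (q.2.1 == q.2.2).
Qed.

Section blocks.
Variables (R : realType) (Psi : square_map R) (K : nat).
Hypothesis K0 : (0 < K)%N.
Local Notation I01 := (`[0, 1]%classic : set R).
Local Notation leb := (@lebesgue_measure R).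
Local Notation T := ('I_K * 'I_K)%type.
Local Notation b := (#|{: T}|%:R : R).

Let K0R : 0 < K%:R :> R. Proof. by rewrite ltr0n. Qed.

Definition block (i : nat) : set R := `[(i%:R / K%:R), (i.+1%:R / K%:R)[%classic.

Lemma blockP i x : block i x <-> i%:R <= K%:R * x < i.+1%:R.
Proof. by rewrite /block /= in_itv/= ler_pdivrMr// ltr_pdivlMr// mulrC. Qed.

Lemma block_lt i j x y : block i x -> block j y -> i != j -> (x < y) = (i < j)%N.
Proof.
rewrite !blockP => /andP[ix xi] /andP[jy yj] ij; rewrite -(ltr_pM2l K0R).
case: (ltngtP i j) ij => // [ij _|ji _].
  by rewrite (lt_le_trans xi)// (le_trans _ jy)// ler_nat.
by apply/negbTE; rewrite -leNgt (le_trans (ltW yj))// (le_trans _ ix)// ler_nat.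
Qed.

Lemma block01 (i : 'I_K) x : block i x -> 0 <= x < 1.
Proof.
rewrite blockP => /andP[ix xi]; apply/andP; split.
  by rewrite -(pmulr_rge0 _ K0R) (le_trans _ ix).
by rewrite -(ltr_pM2l K0R) mulr1 (lt_le_trans xi)// ler_nat.
Qed.

Lemma lebesgue_block i : leb (block i) = (K%:R^-1)%:E.
Proof.
rewrite lebesgue_measure_itv/= lte_fin ltr_pM2r ?invr_gt0// ltr_nat ltnSn.
by rewrite -EFinB -natr1; congr _%:E; field; rewrite gt_eqF.
Qed.

Definition block_preimage (t : T) : set R := I01 `&` Psi @^-1` (block t.1 `*` block t.2).

Lemma measurable_block_preimage t : measurable (block_preimage t).
Proof.
apply: square_map_measurable => //.
by apply: measurableX; exact: measurable_itv.
Qed.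

Lemma lebesgue_block_preimage t : leb (block_preimage t) = (b^-1)%:E.
Proof.
have mb i : measurable (block i) by exact: measurable_itv.
rewrite square_map_push; last 2 first.
- exact: measurableX.
- move=> z [/block01/andP[z0 z1] /block01/andP[w0 w1]].
  by split; rewrite /= in_itv/=; apply/andP; split=> //; exact: ltW.
transitivity (leb (block t.1) * leb (block t.2))%E; first by apply: product_measure1E; exact: mb.
by rewrite !lebesgue_block -EFinM card_prod card_ord natrM invfM.
Qed.

(** Inner regularity.  The compact cores of different blocks are at a positive
    distance from each other, which the block preimages need not be. *)
Lemma block_cores (e : R) : 0 < e -> exists V : T -> set R, forall t,
  [/\ compact (V t), V t `<=` block_preimage t & ((b^-1 - e)%:E <= leb (V t))%E].
Proof.
move=> e0; suff /choice[V VP] (t : T) : exists V : set R,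
    [/\ compact V, V `<=` block_preimage t & ((b^-1 - e)%:E <= leb V)%E] by exists V.
have mB := measurable_block_preimage t.
have Bfin : (leb (block_preimage t) < +oo)%E by rewrite lebesgue_block_preimage ltry.
have [V [cV VB VD]] := lebesgue_regularity_inner mB Bfin e0.
exists V; split=> //.
have mV : measurable V by apply: closed_measurable; exact: compact_closed.
have E : leb (block_preimage t) = (leb (block_preimage t `\` V) + leb V)%E.
  by rewrite -[in X in (_ + leb X)%E](setIidr VB); exact: measureDI.
rewrite lebesgue_block_preimage in E; rewrite EFinB E leeBlDl//.
by apply: leeD2r; exact: ltW.
Qed.

Lemma cores_disjoint (V : T -> set R) t t' x :
  (forall t, V t `<=` block_preimage t) -> V t x -> V t' x -> t = t'.
Proof.
move=> VB /VB[_ [h1 h2]] /VB[_ [h1' h2']].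
have E i j y : block i y -> block j y -> i = j.
  move=> hi hj; apply/eqP/negPn/negP => ij.
  have := block_lt hi hj ij; have := block_lt hj hi; rewrite eq_sym => /(_ ij).
  by rewrite ltxx; case: ltngtP ij.
by rewrite (surjective_pairing t) (surjective_pairing t'); congr pair; apply: val_inj;
  [exact: E h1 h1'|exact: E h2 h2'].
Qed.

(** A cell shorter than the distance between the cores meets at most one of them. *)
Lemma cell_labels (V : T -> set R) :
  (forall t, compact (V t)) -> (forall t, V t `<=` block_preimage t) ->
  \forall n \near \oo, exists l : 'I_n -> T,
    forall (c : 'I_n) t x, cell n c x -> V t x -> l c = t.
Proof.
move=> cV VB; have : \forall n \near \oo, forall q : T * T, q.1 != q.2 ->
    forall x y, V q.1 x -> V q.2 y -> n%:R^-1 <= `|x - y|.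
  apply: filter_forall => -[t t'] /=; have [->|tt'] := eqVneq t t'.
    exact: nearW.
  have : \forall n \near \oo, forall x y, V t x -> V t' y -> n%:R^-1 <= `|x - y|.
    apply: compact_separation => //; apply/seteqP; split => // x [Vx Vx'].
    by case/eqP: tt'; exact: cores_disjoint VB Vx Vx'.
  by apply: filterS => n h _.
apply: filterS => n sep.
suff /choice[l lP] (c : 'I_n) : exists t, forall t' x, cell n c x -> V t' x -> t = t'.
  by exists l.
have [[t [x [cx Vx]]]|nex] := pselect (exists t x, cell n c x /\ V t x); last first.
  exists (Ordinal K0, Ordinal K0) => t' x cx Vx; exfalso; apply: nex.
  by exists t', x.
exists t => t' y cy Vy; apply/eqP/negPn/negP => tt'.
have := sep (t, t') tt' x y Vx Vy; apply/negP; rewrite -ltNge.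
have n0 : (0 < n)%N by exact: leq_ltn_trans (ltn_ord c).
have n0R : 0 < n%:R :> R by rewrite ltr0n.
move: cx cy; rewrite !cellP// -natr1 => /andP[h1 h2] /andP[h3 h4].
rewrite -(ltr_pM2l n0R) divff ?gt_eqF// -[X in X * _](gtr0_norm n0R) -normrM mulrBr.
by rewrite ltr_norml; apply/andP; split; lra.
Qed.

End blocks.

(** * Balanced diagrams are close to the limit *)

Section balanced_is_close.
Variables (R : realType) (Psi : square_map R).
Local Notation I01 := (`[0, 1]%classic : set R).
Local Notation leb := (@lebesgue_measure R).

Lemma graph_fun_cell n (G : sgraph n) (c c' : 'I_n) (x y : R) :
  cell n c x -> cell n c' y -> graph_fun G (x, y) = (adj G c c')%:R.
Proof.
have n0 : (0 < n)%N by exact: leq_ltn_trans (ltn_ord c).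
rewrite !cell_ceil// => /eqP cx /eqP cy; rewrite /graph_fun /=; congr (nat_of_bool _)%:R.
apply/existsP/idP => [[i /existsP[j /and3P[Gij]]]|Gcc].
  rewrite cx cy !eqz_nat !eqSS => /eqP ci /eqP cj.
  by rewrite (val_inj ci) (val_inj cj).
by exists c; apply/existsP; exists c'; rewrite Gcc cx cy !eqxx.
Qed.

(** Points in different blocks are ordered as the blocks are. *)
Lemma circle_fun_block (K : nat) (t t' : 'I_K * 'I_K) (x y : R) : (0 < K)%N ->
  block_preimage Psi t x -> block_preimage Psi t' y ->
  uniq [:: t.1; t.2; t'.1; t'.2] ->
  circle_fun Psi (x, y) = (cross4 t.1 t.2 t'.1 t'.2)%:R.
Proof.
move=> K0 [_ /= [p1 p2]] [_ /= [q1 q2]] ut.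
rewrite /circle_fun /=; congr (nat_of_bool _)%:R.
have lt_block (i j : 'I_K) (u v : R) : block K i u -> block K j v -> i != j ->
    (u < v) = (i < j)%N by exact: block_lt.
have ne_block (i j : 'I_K) (u v : R) : block K i u -> block K j v -> i != j -> u != v.
  move=> hu hv ij; apply/eqP => uv; rewrite uv in hu.
  have := lt_block _ _ _ _ hu hv ij; have := lt_block _ _ _ _ hv hu.
  by rewrite eq_sym ltxx => /(_ ij); move: ij; rewrite -val_eqE /=; case: ltngtP.
have /= := ut; rewrite !inE !negb_or andbT => /andP[/and3P[n1 n2 n3] /andP[/andP[n4 n5] n6]].
have uP : uniq [:: (Psi x).1; (Psi x).2; (Psi y).1; (Psi y).2].
  rewrite /= !inE !negb_or andbT (ne_block _ _ _ _ p1 p2 n1) (ne_block _ _ _ _ p1 q1 n2).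
  rewrite (ne_block _ _ _ _ p1 q2 n3) (ne_block _ _ _ _ p2 q1 n4).
  by rewrite (ne_block _ _ _ _ p2 q2 n5) (ne_block _ _ _ _ q1 q2 n6).
have in01 : {in [:: (Psi x).1; (Psi x).2; (Psi y).1; (Psi y).2], forall u, 0 <= u < 1}.
  move=> u; rewrite !inE => /or4P[] /eqP ->.
  - exact: block01 p1.
  - exact: block01 p2.
  - exact: block01 q1.
  - exact: block01 q2.
have [|mC Cm] := chord_meet uP.
  by move=> u v /in01 hu /in01 hv; rewrite ltr_norml; lra.
rewrite (_ : cross4 t.1 t.2 t'.1 t'.2 = cross4 (Psi x).1 (Psi x).2 (Psi y).1 (Psi y).2).
  by apply/asboolP/idP => [[_ /mC]|/Cm].
rewrite /cross4 (lt_block _ _ _ _ p1 q1 n2) (lt_block _ _ _ _ p2 q1 n4).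
by rewrite (lt_block _ _ _ _ p1 q2 n3) (lt_block _ _ _ _ p2 q2 n5).
Qed.

Lemma adj_types (n K : nat) (f : {ffun 'I_n * bool -> 'I_(n.*2)})
    (g : {ffun 'I_(n.*2) -> 'I_K}) (c c' : 'I_n) :
  let t := chord_types g f c in let t' := chord_types g f c' in
  f \in diagrams n -> (forall p q : 'I_(n.*2), (p <= q)%N -> (g p <= g q)%N) ->
  uniq [:: t.1; t.2; t'.1; t'.2] ->
  adj (diagram_graph f) c c' = cross4 t.1 t.2 t'.1 t'.2.
Proof.
move=> t t' fd gm ut; have cc' : c != c'.
  apply: contraTneq ut; rewrite /t /t' => ->.
  by rewrite /= !inE eqxx orbT.
rewrite (adj_diagram fd cc' false false).
have lt_g p q : g p != g q -> (p < q)%N = (g p < g q)%N.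
  move=> gpq; rewrite [RHS]ltn_neqAle gpq /=; case: ltnP => pq; first by rewrite gm // ltnW.
  by apply/esym/negbTE; rewrite -ltnNge ltn_neqAle eq_sym gpq gm.
have := ut; rewrite /= !inE !negb_or andbT => /andP[/and3P[_ n2 n3] /andP[/andP[n4 n5] _]].
move: n2 n3 n4 n5; rewrite /t /t' !ffunE /= => n2 n3 n4 n5.
by rewrite /cross4 !ltEord !lt_g.
Qed.

Lemma lebesgue01D (W : set R) (r : R) : measurable W -> W `<=` I01 ->
  ((1 - r)%:E <= leb W)%E -> (leb (I01 `\` W) <= r%:E)%E.
Proof.
move=> mW W01 rW; have mI : measurable I01 by exact: measurable_itv.
have I1 : leb I01 = 1%:E by rewrite lebesgue_measure_itv/= lte_fin ltr01 -EFinB subr0.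
have E : leb I01 = (leb (I01 `\` W) + leb W)%E.
  by rewrite -[in X in (_ + leb X)%E](setIidr W01); exact: measureDI.
have : (leb (I01 `\` W) + (1 - r)%:E <= 1%:E)%E by rewrite -I1 E leeD2l.
by rewrite -leeBrDr// -EFinB opprB addrC subrK.
Qed.

Lemma lebesgue_cells_value (n : nat) (T : finType) (a : 'I_n -> T) (t : T) : (0 < n)%N ->
  (leb (\big[setU/set0]_(c < n | a c == t) cell n c) <=
   (#|[set c | a c == t]%SET|%:R / n%:R)%:E)%E.
Proof.
move=> n0; apply: le_trans (measure_bigsetU_le _ _ _ _) _.
  by move=> i; exact: measurable_cell.
rewrite (eq_bigr (fun=> (n%:R^-1)%:E)) => [|c _]; last exact: lebesgue_cell.
rewrite sumEFin lee_fin sumr_const mulr_natl.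
by rewrite -cardsE lexx.
Qed.

Lemma core_count (n : nat) (T : finType) (l : 'I_n -> T) (V : T -> set R) (r : R) (t : T) :
  (0 < n)%N -> measurable (V t) -> V t `<=` I01 ->
  (forall (c : 'I_n) x, cell n c x -> V t x -> l c = t) ->
  (r%:E <= leb (V t))%E -> r * n%:R <= #|[set c | l c == t]%SET|%:R.
Proof.
move=> n0 mV V01 lV; rewrite (lebesgue_cells n0 mV V01) => rV.
have n0R : 0 < n%:R :> R by rewrite ltr0n.
rewrite -ler_pdivlMr// -lee_fin; apply: (le_trans rV).
rewrite (bigID (fun c => l c == t)) /= [X in (_ + X)%E]big1 ?adde0.
  apply: (@le_trans _ _ (\sum_(c < n | l c == t) (n%:R^-1)%:E)%E); last first.
    by rewrite sumEFin lee_fin sumr_const mulr_natl -cardsE.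
  apply: lee_sum => c _; rewrite -(lebesgue_cell R c n0); apply: le_measure; rewrite ?inE//.
    by apply: measurableI => //; exact: measurable_cell.
  exact: measurable_cell.
move=> c lc; rewrite (_ : _ `&` _ = set0) ?measure0//.
apply/seteqP; split => // x [cx Vx]; move: lc; rewrite (lV c x)//.
by rewrite eqxx.
Qed.

(** Up to the point [0], each core is the disjoint union of its traces on the cells
    carrying its label. *)
Lemma cores_measure (n : nat) (T : finType) (l : 'I_n -> T) (V : T -> set R) (r : R) :
  (0 < n)%N -> (forall t, measurable (V t)) -> (forall t, V t `<=` I01) ->
  (forall (c : 'I_n) t x, cell n c x -> V t x -> l c = t) ->
  (forall t, (r%:E <= leb (V t))%E) ->
  ((#|T|%:R * r)%:E <= leb (\big[setU/set0]_(c < n) (cell n c `&` V (l c))))%E.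
Proof.
move=> n0 mV V01 lV rV.
have mcV (c : 'I_n) t : measurable (cell n c `&` V t : set R).
  by apply: measurableI => //; exact: measurable_cell.
rewrite measure_bigsetU_ord; last 2 first.
- by move=> c; exact: mcV.
- apply/trivIsetP => i j _ _ ij; apply/seteqP; split => // x [[ci _] [cj _]].
  by case/eqP: ij; apply: val_inj; exact: cell_uniq ci cj.
rewrite (partition_big l xpredT) //= mulr_natl -sumr_const -sumEFin.
apply: lee_sum => t _; apply: (le_trans (rV t)).
rewrite (lebesgue_cells n0 (mV t) (V01 t)) (bigID (fun c => l c == t)) /=.
rewrite [X in (_ + X)%E]big1 ?adde0.
  by apply: lee_sum => c /eqP ->.
move=> c lc; rewrite (_ : _ `&` _ = set0) ?measure0//.
apply/seteqP; split => // x [cx Vx]; move: lc; rewrite (lV c t x)//.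
by rewrite eqxx.
Qed.

Lemma rectangle_le (X Y : set R) (r s : R) : measurable X -> measurable Y ->
  (leb X <= r%:E)%E -> (leb Y <= s%:E)%E -> ((leb \x leb)%E (X `*` Y) <= (r * s)%:E)%E.
Proof.
move=> mX mY Xr Ys; rewrite [leLHS](_ : _ = leb X * leb Y)%E; last exact: product_measure1E.
by rewrite EFinM; apply: lee_pmul => //; exact: measure_ge0.
Qed.

(** The labels [l] of the cells and the chord types [a] have nearly the same
    value counts, so a permutation [s] of the cells matches them up to few errors.  The
    graphons may differ at [(x, y)] only if [x] or [y] is in the set [N] of points that
    lie in a mismatched cell or are sent outside of the cores, or if the four arcs of
    the two chords are not distinct. *)
Lemma balanced_cut_dist_le (K n : nat) (e : R) (V : 'I_K * 'I_K -> set R)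
    (l : 'I_n -> 'I_K * 'I_K) (f : {ffun 'I_n * bool -> 'I_(n.*2)}) :
  let b := (K * K)%:R : R in
  (0 < K)%N -> (0 < n)%N -> 0 < e -> e * b ^+ 2 <= 1 ->
  (forall t, [/\ compact (V t), V t `<=` block_preimage Psi t &
                 ((b^-1 - e)%:E <= leb (V t))%E]) ->
  (forall (c : 'I_n) t x, cell n c x -> V t x -> l c = t) ->
  f \in diagrams n -> balanced K e f ->
  (cut_dist (graph_graphon R (diagram_graph f)) (circle_graphon Psi) <=
   (4 * b ^+ 2 * e + 24 / K%:R)%:E)%E.
Proof.
move=> b K0 n0 e0 eb VP lV fd /existsP[g /andP[gm gb]].
have n0R : 0 < n%:R :> R by rewrite ltr0n.
have K0R : 0 < K%:R :> R by rewrite ltr0n.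
have bT : #|{: 'I_K * 'I_K}|%:R = b by rewrite card_prod card_ord.
have b1 : 1 <= b by rewrite ler1n muln_gt0 K0.
have {gm}gm (p q : 'I_(n.*2)) : (p <= q)%N -> (g p <= g q)%N.
  by move/forallP: gm => /(_ p)/forallP/(_ q)/implyP.
pose a := chord_types g f.
have la t : (#|{: 'I_K * 'I_K}|%:R^-1 - e) * n%:R <= #|[set c | a c == t]%SET|%:R.
  rewrite leNgt; apply: contraNN gb => h; rewrite inE; apply/existsP; exists t.
  by [].
have mV t : measurable (V t).
  by have [cV _ _] := VP t; apply: closed_measurable; exact: compact_closed.
have V01 t : V t `<=` I01 by have [_ VB _] := VP t; move=> x /VB[].
have ll t : (#|{: 'I_K * 'I_K}|%:R^-1 - e) * n%:R <= #|[set c | l c == t]%SET|%:R.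
  apply: (core_count (V := V)) => //; first by move=> c x; exact: lV.
  by rewrite bT; have [] := VP t.
have [s sP] := close_counts_perm (ltW e0) la ll.
pose phi := exchange s : R -> R.
have mphi : measurable_fun setT phi by exact: measurable_exchange.
pose W := \big[setU/set0]_(c < n) (cell n c `&` V (l c)) : set R.
have mW : measurable W.
  by apply: bigsetU_measurable => c _; apply: measurableI => //; exact: measurable_cell.
have W01 : W `<=` I01.
  by rewrite /W; elim/big_ind: _ => // [A1 A2 h1 h2 x [/h1|/h2]//|c _ x [_ /V01]].
(* [N1]: points sent outside of the cores; [N2]: points of the mismatched cells *)
pose N1 := I01 `&` phi @^-1` (I01 `\` W).
pose N2 := \big[setU/set0]_(c < n | l (s c) != a c) cell n c : set R.
pose N := [set 0] `|` (N1 `|` N2).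
have mI : measurable I01 by exact: measurable_itv.
have mN1 : measurable N1 by apply: measurable_funTS => //; exact: measurableD.
have mN2 : measurable N2 by apply: bigsetU_measurable => c _; exact: measurable_cell.
have mN : measurable N by apply: measurableU => //; exact: measurableU.
have N1le : (leb N1 <= (b * e)%:E)%E.
  have [_ _ ->] := exchange_preserving R s n0; last 2 first.
  - exact: measurableD.
  - by move=> x [].
  apply: lebesgue01D => //.
  rewrite (_ : 1 - b * e = b * (b^-1 - e)); last by field; rewrite gt_eqF//; lra.
  rewrite -{1}bT; apply: cores_measure => // t; by have [] := VP t.
have N2le : (leb N2 <= (b ^+ 2 * e)%:E)%E.
  apply: le_trans (measure_bigsetU_le _ _ _ _) _; first by move=> i; exact: measurable_cell.
  rewrite (eq_bigr (fun=> (n%:R^-1)%:E)) => [|c _]; last exact: lebesgue_cell.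
  rewrite sumEFin lee_fin sumr_const -[leLHS]mulr_natl ler_pdivrMr//.
  by rewrite -bT -cardsE.
have Nle : (leb N <= (2 * b ^+ 2 * e)%:E)%E.
  apply: (@le_trans _ _ (0 + ((b * e)%:E + (b ^+ 2 * e)%:E))%E).
    apply: le_trans (measureU2 _ _ _) _ => //; first exact: measurableU.
    have s0 : (leb ([set 0%R] : set R) <= 0)%E by rewrite lebesgue_measure_set1.
    apply: leeD; first exact: s0.
    by apply: le_trans (measureU2 _ _ _) _ => //; exact: leeD.
  rewrite add0e -EFinD lee_fin; have : b * e <= b ^+ 2 * e by rewrite ler_pM2r//; nra.
  by lra.
pose A t := \big[setU/set0]_(c < n | a c == t) cell n c : set R.
have mA t : measurable (A t) by apply: bigsetU_measurable => c _; exact: measurable_cell.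
have Ale t : (leb (A t) <= (2 / b)%:E)%E.
  apply: (le_trans (lebesgue_cells_value a t n0)); rewrite lee_fin ler_pdivrMr//.
  have := value_counts_le la t; rewrite bT => /le_trans; apply.
  have : b * e <= b^-1 by rewrite -[leRHS]mul1r ler_pdivlMr; lra.
  have : 0 <= e * n%:R by rewrite mulr_ge0 ?ltW.
  by nra.
(* [C]: pairs of points whose chords do not have four distinct arcs *)
pose C := \big[setU/set0]_(q : ('I_K * 'I_K) * ('I_K * 'I_K) |
  ~~ uniq [:: q.1.1; q.1.2; q.2.1; q.2.2]) (A q.1 `*` A q.2) : set (R * R).
have mAA q : measurable (A q.1 `*` A q.2) by exact: measurableX.
have mC : measurable C by apply: bigsetU_measurable => q _.
have mNI : measurable (N `*` I01) by exact: measurableX.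
have mIN : measurable (I01 `*` N) by exact: measurableX.
have I1 : leb I01 = 1%:E by rewrite lebesgue_measure_itv/= lte_fin ltr01 -EFinB subr0.
have Cle : ((leb \x leb)%E C <= (24 / K%:R)%:E)%E.
  apply: le_trans (measure_bigsetU_le _ _ _ _) _ => //.
  apply: (@le_trans _ _ (\sum_(q : ('I_K * 'I_K) * ('I_K * 'I_K) |
      ~~ uniq [:: q.1.1; q.1.2; q.2.1; q.2.2]) ((2 / b) ^+ 2)%:E)%E).
    by apply: lee_sum => q _; apply: rectangle_le.
  rewrite sumEFin lee_fin sumr_const -[leLHS]mulr_natl.
  apply: (@le_trans _ _ ((6 * K ^ 3)%:R * (2 / b) ^+ 2)).
    by apply: ler_wpM2r; rewrite ?sqr_ge0// ler_nat card_conflicting.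
  rewrite /b !natrM le_eqVlt; apply/orP; left; apply/eqP.
  by field; rewrite gt_eqF.
apply: (cut_dist_le (phi := phi) (E := (N `*` I01) `|` ((I01 `*` N) `|` C))) => //.
- exact: exchange_invertible.
- by apply: measurableU => //; exact: measurableU.
- move=> x y x01 y01 nE.
  have nNx : ~ N x by move=> Nx; apply: nE; left.
  have nNy : ~ N y by move=> Ny; apply: nE; right; left.
  have located z : I01 z -> ~ N z ->
      exists2 c : 'I_n, cell n c z & block_preimage Psi (a c) (phi z).
    move=> z01 nNz; have [z0|[c cz]] := itv01_cases n0 z01.
      by exfalso; apply: nNz; left.
    exists c => //; have pcz := exchange_in_cell s cz.
    have Wz : W (phi z).
      apply: contrapT => nW; apply: nNz; right; left; split => //; split => //.
      by apply: (@exchange01 R n s n0); exists z.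
    have : exists2 d : 'I_n, cell n d (phi z) & V (l d) (phi z).
      move: Wz; rewrite /W; elim/big_ind: _ => // [A1 A2 h1 h2 [/h1|/h2]//|d _ [h1 h2]].
      by exists d.
    move=> [d pd Vd]; have ds : d = s c by apply: val_inj; exact: cell_uniq pd pcz.
    rewrite ds in Vd; have [_ VB _] := VP (l (s c)).
    have <- : l (s c) = a c; last exact: VB.
    apply/eqP/negPn/negP => lsa; apply: nNz; right; right.
    exact: (in_bigsetU (i := c)).
  have [c cx px] := located x x01 nNx; have [c' cy py] := located y y01 nNy.
  have ut : uniq [:: (a c).1; (a c).2; (a c').1; (a c').2].
    apply/negPn/negP => nu; apply: nE; right; right.
    apply: (in_bigsetU (i := (a c, a c'))) => //.
    by split; [apply: (in_bigsetU (i := c))|apply: (in_bigsetU (i := c'))].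
  rewrite /= (graph_fun_cell _ cx cy) (circle_fun_block K0 px py ut).
  by rewrite (adj_types fd gm ut).
apply: (@le_trans _ _ ((2 * b ^+ 2 * e)%:E + ((2 * b ^+ 2 * e)%:E + (24 / K%:R)%:E))%E); last first.
  by rewrite -!EFinD lee_fin; lra.
have NI : ((leb \x leb)%E (N `*` I01) <= (2 * b ^+ 2 * e)%:E)%E.
  by rewrite -[X in X%:E]mulr1; apply: rectangle_le; rewrite ?I1.
have IN : ((leb \x leb)%E (I01 `*` N) <= (2 * b ^+ 2 * e)%:E)%E.
  by rewrite -[X in X%:E]mul1r; apply: rectangle_le; rewrite ?I1.
apply: le_trans (measureU2 _ _ _) _ => //; first exact: measurableU.
by apply: leeD => //; apply: le_trans (measureU2 _ _ _) _ => //; exact: leeD.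
Qed.

Lemma balanced_close (eps : R) : 0 < eps ->
  exists (K : nat) (e : R), [/\ (0 < K)%N, 0 < e <= 1 & \forall n \near \oo,
    forall f : {ffun 'I_n * bool -> 'I_(n.*2)}, f \in diagrams n -> balanced K e f ->
    (cut_dist (graph_graphon R (diagram_graph f)) (circle_graphon Psi) <= eps%:E)%E].
Proof.
(* [4 * b ^+ 2 * e] and [24 / K] are each made at most [eps / 2] *)
move=> eps0; pose K := (Num.truncn (48 / eps)).+1.
have K0 : (0 < K)%N by [].
have K0R : 0 < K%:R :> R by rewrite ltr0n.
have Kbig : 24 / K%:R <= eps / 2.
  have : 48 / eps < K%:R by exact: truncnS_gt.
  by rewrite ltr_pdivrMr// => h; rewrite ler_pdivrMr//; lra.
pose b := (K * K)%:R : R; have b1 : 1 <= b by rewrite ler1n muln_gt0 K0.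
have b2 : 1 <= b ^+ 2 by rewrite expr_ge1//; lra.
pose m := Num.min eps 1; have m0 : 0 < m by rewrite lt_min eps0 ltr01.
have m1 : m <= 1 by rewrite ge_min lexx orbT.
have me : m <= eps by rewrite ge_min lexx.
pose e := m / (8 * b ^+ 2).
have e0 : 0 < e by rewrite divr_gt0//; lra.
have eE : 8 * (e * b ^+ 2) = m by rewrite /e; field; rewrite gt_eqF//; lra.
exists K, e; split => //; first by rewrite e0 /=; nra.
have [V VP] := block_cores Psi K0 e0.
have cV t : compact (V t) by have [] := VP t.
have VB t : V t `<=` block_preimage Psi t by have [] := VP t.
near=> n => f fd bf.
have [l lV] : exists l : 'I_n -> 'I_K * 'I_K,
    forall (c : 'I_n) t x, cell n c x -> V t x -> l c = t.
  by near: n; exact: cell_labels cV VB.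
have n0 : (0 < n)%N by near: n; exact: nbhs_infty_gt.
apply: (@le_trans _ _ (4 * b ^+ 2 * e + 24 / K%:R)%:E); last by rewrite lee_fin; lra.
apply: (balanced_cut_dist_le (V := V) (l := l)) => //; first by rewrite -/b; lra.
by move=> t; have := VP t; rewrite card_prod card_ord.
Unshelve. all: by end_near. Qed.

End balanced_is_close.

(** * Almost sure convergence *)

Lemma ereal_cvg0 (R : realType) (u : nat -> \bar R) : (forall n, (0 <= u n)%E) ->
  (forall j : nat, \forall n \near \oo, (u n <= (j.+1%:R^-1)%:E)%E) -> u n @[n --> \oo] --> 0%E.
Proof.
move=> u0 uj; apply/fine_cvgP; split.
  have := uj 0%N; apply: filterS => n un; rewrite ge0_fin_numE//.
  exact: le_lt_trans un (ltry _).
apply/cvgrPdist_le => e e0; have [j] := ltr_add_invr e0; rewrite add0r => je.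
have := uj j; apply: filterS => n un; rewrite /= sub0r normrN ger0_norm ?fine_ge0//.
apply: le_trans (ltW je); rewrite -lee_fin fineK//.
by rewrite ge0_fin_numE// (le_lt_trans un)// ltry.
Qed.

Lemma geometric_nneseries_fin (R : realType) (a z : R) : 0 <= a -> 0 < z < 1 ->
  (\sum_(n <oo) (a * z ^+ n)%:E < +oo)%E.
Proof.
move=> a0 /andP[z0 z1]; apply: (@le_lt_trans _ _ (a * (1 - z)^-1)%:E); last exact: ltry.
apply: lime_le.
  by apply: is_cvg_nneseries => n _ _; rewrite lee_fin mulr_ge0// exprn_ge0// ltW.
apply: nearW => n; rewrite sumEFin lee_fin.
by apply: geometric_le_lim => //; rewrite gtr0_norm.
Qed.

Section almost_sure.
Variables (R : realType) (d : measure_display) (Omega : measurableType d)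
  (P : probability Omega R).

Lemma uniform_circle_graph_event n (G : Omega -> ugraph n) (B : {set ugraph n}) :
  uniform_circle_graph P G ->
  measurable (G @^-1` [set u | u \in B]) /\
  (P (G @^-1` [set u | u \in B]) <=
   (#|circle_graphs R n :&: B|%SET%:R * #|circle_graphs R n|%:R^-1)%:E)%E.
Proof.
move=> uG; have E : G @^-1` [set u | u \in B] =
    \big[setU/set0]_(u | u \in B) G @^-1` [set u].
  apply/seteqP; split => [w Bw|w]; first exact: (in_bigsetU (i := G w)).
  elim/big_ind: _ => // [A1 A2 h1 h2 [/h1|/h2]//|u uB /= ->//].
have mG u : measurable (G @^-1` [set u]) by have [] := uG u.
split; first by rewrite E; apply: bigsetU_measurable.
rewrite E; apply: le_trans (measure_bigsetU_le _ _ _ _) _ => //.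
rewrite (eq_bigr (fun u => (if u \in circle_graphs R n then #|circle_graphs R n|%:R^-1 else 0)%:E)).
  rewrite sumEFin lee_fin -big_mkcondr /= sumr_const mulr_natl le_eqVlt; apply/orP; left.
  by apply/eqP; congr (_ *+ _); apply: eq_card => u; rewrite finset.in_setI unfold_in andbC.
by move=> u _; have [_ h] := uG u; exact: h.
Qed.

(** Borel-Cantelli: the events that [G n] has no balanced diagram have summable
    probabilities, and from some [n] on the other graphs are close to the limit. *)
Lemma eventually_close (G : forall n : nat, Omega -> ugraph n) (Psi : square_map R) (eps : R) :
  (forall n : nat, (1 <= n)%N -> uniform_circle_graph P (G n)) -> 0 < eps ->
  {ae P, forall w, \forall n \near \oo,
    (cut_dist (unlabeled_graphon R (G n w)) (circle_graphon Psi) <= eps%:E)%E}.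
Proof.
move=> uG eps0; have [K [e [K0 e01 close]]] := balanced_close Psi eps0.
have [n0 rare] := unbalanced_graphs_rare K0 e01.
have /andP[e0 e1] := e01.
have [n1 _ n1P] := close.
pose n2 := maxn n0 (maxn n1 1).
pose B n : {set ugraph n} := (unbalanced_graphs K n e :|: ~: circle_graphs R n)%SET.
pose F n := if (n2 <= n)%N then G n @^-1` [set u | u \in B n] else set0.
pose z := expR (- (e ^+ 2 / 8)) : R.
have z01 : 0 < z < 1.
  by rewrite expR_gt0 -expR0 ltr_expR oppr_lt0 divr_gt0 ?exprn_gt0.
have n2_le n : (n2 <= n)%N -> [/\ (n0 <= n)%N, (n1 <= n)%N & (1 <= n)%N].
  by rewrite /n2 !geq_max => /and3P[].
have mF n : measurable (F n).
  rewrite /F; case: ifPn => // /n2_le[_ _ n1n].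
  by have [] := uniform_circle_graph_event (B n) (uG n n1n).
have PF n : (P (F n) <= ((K * K)%:R * z ^+ n)%:E)%E.
  have a0 : 0 <= (K * K)%:R * z ^+ n :> R.
    by rewrite mulr_ge0// exprn_ge0// expR_ge0.
  rewrite /F; case: ifPn => [/n2_le[n0n _ n1n]|_]; last by rewrite measure0 lee_fin.
  have [_ /le_trans] := uniform_circle_graph_event (B n) (uG n n1n); apply.
  rewrite lee_fin (_ : (_ :&: _)%SET = unbalanced_graphs K n e); last first.
    by apply/setP => u; rewrite !inE; case: asboolP => //= _; rewrite orbF.
  have [C0|C0] := posnP #|circle_graphs R n|; first by rewrite C0 invr0 mulr0.
  rewrite ler_pdivrMr ?ltr0n//; have := rare n n0n.
  by rewrite /z -expRM_natr.
have /lim_sup_set_cvg0 : (\sum_(n <oo) P (F n) < +oo)%E.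
  apply: le_lt_trans (geometric_nneseries_fin (a := (K * K)%:R) _ z01) => //.
  by apply: lee_nneseries => // n _; exact: PF.
move=> /(_ mF) limF; exists (lim_sup_set F); split => //.
  by apply: bigcap_measurable => // k _; exact: bigcup_measurable.
move=> w; apply: contra_notP => nw.
have [m mP] : exists m, forall n, (m <= n)%N -> ~ F n w.
  apply: contrapT => nex; apply: nw => k _; apply: contrapT => nk; apply: nex.
  by exists k => n kn Fn; apply: nk; exists n.
exists (maxn m n2) => // n /=; rewrite geq_max => /andP[mn n2n].
have [_ n1n _] := n2_le n n2n.
have := mP n mn; rewrite /F n2n /= => /negP; rewrite finset.in_setU finset.in_setC.
rewrite negb_or negbK => /andP[+ cu].
rewrite finset.in_set cu /= negb_forall_in => /existsP[f /andP[fd]].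
rewrite negb_imply negbK => /andP[/eqP fu bf].
rewrite /unlabeled_graphon -fu; exact: (n1P n n1n f fd bf).
Qed.

End almost_sure.

Theorem theorem2p2 (R : realType) (d : measure_display)
    (Omega : measurableType d) (P : probability Omega R)
    (G : forall n : nat, Omega -> ugraph n) (Psi : square_map R) :
  (forall n : nat, (1 <= n)%N -> uniform_circle_graph P (G n)) ->
  {ae P, forall w : Omega,
    cut_dist (unlabeled_graphon R (G n w)) (circle_graphon Psi) @[n --> \oo]
      --> 0%E}.
Proof.
move=> uG; have /ae_foralln : forall j : nat, {ae P, forall w, \forall n \near \oo,
    (cut_dist (unlabeled_graphon R (G n w)) (circle_graphon Psi) <= (j.+1%:R^-1)%:E)%E}.
  by move=> j; apply: eventually_close => //; rewrite invr_gt0 ltr0n.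
apply: filterS => w close; apply: ereal_cvg0 => [n|//].
exact: cut_dist_ge0.
Qed.
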